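(* Let $(P_k)_{k\ge1}$ be Markov kernels on a measurable space $(\mathsf{X},\mathcal{B}(\mathsf{X}))$ satisfying the drift and minorisation condition (defined in the context) with $\phi(v)=\beta v^\alpha$ for some constants $\beta>0$, $\alpha\in[0,1)$, with $\epsilon_b\in(0,1)$, and with some $C,V,(\nu_k)_{k\ge1},\epsilon_\nu,b_V,c_V$. Then for any $\xi\in[0,1]$ and any measurable function $f:\mathsf{X}\to\mathbb{R}$ with $$\|f\|_{V^{\alpha(1-\xi)}}=\sup_{x\in\mathsf{X}}\frac{|f(x)|}{V^{\alpha(1-\xi)}(x)}<\infty,$$ there exists a constant $c_{\alpha,\beta,\epsilon_b,\xi}<\infty$ depending only on $\alpha,\beta,\epsilon_b$ and $\xi$ such that for all $x,x'\in\mathsf{X}$, $$\sum_{n\ge0}(n+1)^{\frac{\xi\alpha}{1-\alpha}}\big|P^{(n)}f(x)-P^{(n)}f(x')\big|\le c_{\alpha,\beta,\epsilon_b,\xi}\;c\;\|f\|_{V^{\alpha(1-\xi)}}\big(V(x)+V(x')-1\big),$$ where $c<\infty$ is the explicit constant defined in the context (with $\phi(v)=\beta v^\alpha$).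
   Context: Notation: $\mathbb{I}\{\cdot\}$ is the indicator; $Pf(x)=\int P(x,\mathrm{d}y)f(y)$; $P^{(n)}=P_1P_2\cdots P_n$ (composition of kernels) for $n\ge1$, $P^{(0)}(x,A)=\mathbb{I}\{x\in A\}$. Empty products equal 1. Drift and minorisation condition. Markov kernels $(P_k)_{k\ge1}$ on $(\mathsf{X},\mathcal{B}(\mathsf{X}))$ satisfy it with $C,V,\phi,(\nu_k),\epsilon_\nu,\epsilon_b,b_V,c_V$ if: $C\in\mathcal{B}(\mathsf{X})$; $V:\mathsf{X}\to[1,\infty)$ is measurable; $\phi:[1,\infty)\to(0,\infty)$ is concave, non-decreasing, differentiable with $\lim_{t\to\infty}\phi'(t)=0$; $(\nu_k)_{k\ge1}$ are probability measures on $\mathsf{X}$; $\epsilon_\nu,\epsilon_b\in(0,1)$, $b_V,c_V<\infty$ are constants; and for all $k\ge1$: (1) $P_kV(x)\le V(x)-\phi(V(x))+b_V\mathbb{I}\{x\in C\}$ for all $x$; (2) $P_k(x,\cdot)\ge\epsilon_\nu\nu_k(\cdot)$ for all $x\in C$; (3) $\inf_{x\notin C}\phi(V(x))\ge b_V(1-\epsilon_b)^{-1}$ and $\sup_{x\in C}V(x)\le c_V$. Constant $c$. With $H_\phi(t)=\int_1^t\frac{\mathrm{d}s}{\phi(s)}$ for $t\ge 1$ and $r(n)=\phi(H_\phi^{-1}(\epsilon_bn))/\phi(1)$ for $n\in\{0,1,2,\dots\}$, set $$c=\frac{2}{\epsilon_b\phi(1)}\bigg[2+\frac{\bar b}{\epsilon_\nu}+c_*\bar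 b\,r(1)\Big(1+\frac{r(1)}{\epsilon_b\phi(1)}\Big)\bigg],$$ where $\bar b=2b_V+\epsilon_b\phi(1)$, $c_*=\sum_{j=1}^\infty(1-\epsilon_\nu)^{j-1}\prod_{k=1}^{j-1}(1+\delta_kM_1)$, $\delta_k=\epsilon_b\phi'(H_\phi^{-1}(\epsilon_bk))$ and $M_1=r(1)\Big[1+\frac{2r(1)}{\epsilon_b\phi(1)}\Big(\frac{b_V+c_V}{1-\epsilon_\nu}-1\Big)\Big]$. *)

(* Defs.v *)
From HB Require Import structures.
From mathcomp Require Import all_boot all_order all_algebra.
From mathcomp Require Import all_classical all_reals all_analysis.

Set Implicit Arguments.
Unset Strict Implicit.
Unset Printing Implicit Defensive.

Import Order.TTheory GRing.Theory Num.Theory.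
Import numFieldNormedType.Exports.

Local Open Scope classical_set_scope.
Local Open Scope ring_scope.

(* A sequence (P_k)_{k >= 1} is encoded as a function on nat whose value at 0
   is never used. *)

(* P^(n) = P_1 P_2 ... P_n. *)
Fixpoint kernel_prod (d : measure_display) (X : measurableType d)
    (R : realType) (P : nat -> R.-pker X ~> X) (n : nat) : R.-spker X ~> X :=
  match n with
  | 0 => kdirac (@measurable_id _ X setT)
  | m.+1 => mkcomp_noparam (kernel_prod P m) (P m.+1)
  end.

(* P f (x); the integral is that of the library, with values in \bar R. *)
Definition kernel_app (d : measure_display) (X : measurableType d)
    (R : realType) (P : X -> {measure set X -> \bar R}) (f : X -> R) (x : X)
    : \bar R :=
  (\int[P x]_y (f y)%:E)%E.

(* The conditions on phi : [1, oo[ -> ]0, oo[, with phi given as a function on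
   R of which only the values on [1, oo[ matter; in particular differentiability
   at 1 is from the right. *)
Record drift_rate (R : realType) (phi : R -> R) : Prop := DriftRate {
  rate_gt0 : forall t, 1 <= t -> 0 < phi t ;
  rate_concave : @convex_function R R^o [set t | 1 <= t] (fun t => - phi t) ;
  rate_nondecreasing : {in `[1, +oo[ &, {homo phi : s t / s <= t}} ;
  rate_derivable : forall t, 1 < t -> derivable phi t 1 ;
  rate_derivable1 : cvg ((phi (1 + h) - phi 1) / h @[h --> 0^'+]) ;
  rate_derive_cvg0 : derive1 phi t @[t --> +oo] --> 0
}.

Record drift_minorisation (d : measure_display) (X : measurableType d)
    (R : realType) (P : nat -> R.-pker X ~> X) (C : set X) (V : X -> R)
    (phi : R -> R) (nu : nat -> probability X R)
    (eps_nu eps_b b_V c_V : R) : Prop := DriftMinorisation {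
  dm_C_measurable : measurable C ;
  dm_V_measurable : measurable_fun setT V ;
  dm_V_ge1 : forall x, 1 <= V x ;
  dm_rate : drift_rate phi ;
  dm_eps_nu : 0 < eps_nu < 1 ;
  dm_eps_b : 0 < eps_b < 1 ;
  dm_drift : forall k x, (0 < k)%N ->
    (kernel_app (P k) V x <= (V x - phi (V x) + b_V * \1_C x)%:E)%E ;
  dm_minorisation : forall k x A, (0 < k)%N -> C x -> measurable A ->
    (eps_nu%:E * nu k A <= P k x A)%E ;
  dm_out : ((b_V * (1 - eps_b)^-1)%:E <=
    ereal_inf [set (phi (V x))%:E | x in ~` C])%E ;
  dm_in : (ereal_sup [set (V x)%:E | x in C] <= c_V%:E)%E
}.

Definition H_rate (R : realType) (phi : R -> R) (t : R) : R :=
  \int[lebesgue_measure]_(s in `[1, t]) (phi s)^-1.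

(* Inverse of H_rate phi : [1, oo[ -> [0, oo[ (default value 1 off the range). *)
Definition H_rate_inv (R : realType) (phi : R -> R) : R -> R :=
  'pinv_(fun=> 1) [set t | 1 <= t] (H_rate phi).

Section constants.
Variables (R : realType) (phi : R -> R) (eps_nu eps_b b_V c_V : R).

Definition r_rate (n : nat) : R :=
  phi (H_rate_inv phi (eps_b * n%:R)) / phi 1.

Definition delta_rate (k : nat) : R :=
  eps_b * derive1 phi (H_rate_inv phi (eps_b * k%:R)).

Definition M1_const : R :=
  r_rate 1 * (1 + 2 * r_rate 1 / (eps_b * phi 1)
                  * ((b_V + c_V) / (1 - eps_nu) - 1)).

Definition bbar_const : R := 2 * b_V + eps_b * phi 1.

(* c_* and c are extended reals, so that their finiteness is a statement and
   not a convention. *)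
Definition cstar_const : \bar R :=
  (\sum_(1 <= j <oo)
     ((1 - eps_nu) ^+ j.-1 *
      \prod_(1 <= k < j) (1 + delta_rate k * M1_const))%:E)%E.

Definition c_const : \bar R :=
  ((2 / (eps_b * phi 1))%:E *
   ((2 + bbar_const / eps_nu)%:E +
    cstar_const *
    (bbar_const * r_rate 1 * (1 + r_rate 1 / (eps_b * phi 1)))%:E))%E.

End constants.

Definition weighted_norm (X : Type) (R : realType) (W f : X -> R) : \bar R :=
  ereal_sup [set (`|f x| / W x)%:E | x in [set: X]].

(* Main.v *)
Require Import Defs.
From HB Require Import structures.
From mathcomp Require Import all_boot all_order all_algebra.
From mathcomp Require Import all_classical all_reals all_analysis.
From mathcomp Require Import measurable_realfun.
From mathcomp Require Import ring lra.

Set Implicit Arguments.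
Unset Strict Implicit.
Unset Printing Implicit Defensive.

Import Order.TTheory GRing.Theory Num.Theory.
Import numFieldNormedType.Exports.

Local Open Scope classical_set_scope.
Local Open Scope ring_scope.

(** The argument couples two copies of the chain: they move independently
    until both are in [C], where a step makes them meet with probability at
    least [eps_nu]. Before they meet, [|f|] at the time [n], weighted by the
    power [xi * alpha / (1 - alpha)] of [n.+1], is at most a constant times
    [r n `^ xi * (V `^ alpha) `^ (1 - xi)], hence at most a constant times
    [r n + V `^ alpha] ([polynomial_weight_le], [powR_interpolation]). It
    remains to bound the expected sum of
    [2 * r n + V x_n `^ alpha + V x'_n `^ alpha] until the chains meet by a
    multiple of the constant [c] and of [v = V x + V x' - 1].

    For the sum of [V `^ alpha], the function [v] itself has the right
    drift. For the sum of the rates, the function is [lyap k v], which is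
    [H^-1 (H v + eps_b * k) - H^-1 (eps_b * k)] with [H] the primitive of
    [phi^-1]: it is concave in [v], at most [r k * (v - 1)], and loses
    [eps_b * beta * r k] at each step outside [C `*` C] ([lyap_drift]). A
    step from [C `*` C] at time [k] costs an excess proportional to
    [r k.+1]. Between two visits to [C `*` C] the mean of the rate is
    multiplied by at most [1 + delta k * M1], and the chains fail to meet
    with probability [1 - eps_nu]: the mean sum of these excesses is thus at
    most a multiple of the series [c_*]. The series converges since
    [delta k] tends to 0 ([cstar_fin_num]). The function [pair_lyap]
    collects these bounds, and [pair_lyap_step] is its one-step inequality.

    The coupling itself is never constructed. All the bounds are concave
    functions of [V x + V x' - 1], so that they may be replaced by a tangent
    line, which is the sum of a function of [x] and of a function of [x'].
    If the oscillation of a function [h] is at most such a sum, the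
    difference of the means of [h] under two measures is at most the sum of
    the corresponding means, and a common part of mass [eps_nu] of the two
    measures can be subtracted on both sides ([mean_diff_minorised]).
    Applied backwards in time to the sum of [f] along the chain, with signs
    that produce the absolute values, this gives the bound up to any horizon
    ([backward_sum_oscillation]), and the constants compare with [c] by
    [pair_lyap_le_c_const]. *)

(** * Inequalities for real powers *)

Section power_inequalities.
Context {R : realType}.
Implicit Types x y a b p q : R.

Lemma ln_le_subr1 x : 0 < x -> ln x <= x - 1.
Proof.
move=> x0; have -> : x = 1 + (x - 1) by ring.
by rewrite (le_trans (le_ln1Dx _)); lra.
Qed.

Lemma powR_le2r a b p : 0 <= p -> 0 <= a -> a <= b -> a `^ p <= b `^ p.
Proof.
by move=> p0 a0 ab; rewrite ge0_ler_powR// nnegrE// (le_trans a0).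
Qed.

Lemma one_powR p : (1 : R) `^ p = 1. Proof. by rewrite powR1. Qed.

(** The weighted arithmetic-geometric mean inequality for [x] and [1]: the
    tangent of [ln] at the mean [m] bounds both [ln x] and [ln 1]. *)
Lemma powR_bernoulli x q : 0 < x -> 0 <= q <= 1 -> x `^ q <= 1 + q * (x - 1).
Proof.
move=> x0 /andP[q0 q1]; set m := 1 + q * (x - 1).
have m0 : 0 < m.
  rewrite /m; have [q_eq1|q_neq1] := eqVneq q 1; first by rewrite q_eq1; lra.
  have : 0 <= q * x by rewrite mulr_ge0// ltW.
  have : q < 1 by rewrite lt_neqAle q_neq1.
  by rewrite mulrBr mulr1; lra.
rewrite /powR gt_eqF// -[leRHS]lnK ?posrE// ler_expR.
have xm : ln x - ln m <= x / m - 1.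
  by rewrite -ln_div ?posrE// ln_le_subr1// divr_gt0.
have im : - ln m <= m^-1 - 1.
  by rewrite -lnV ?posrE// ln_le_subr1// invr_gt0.
(* the average of the two bounds with weights q and 1 - q vanishes *)
have : q * (ln x - ln m) + (1 - q) * (- ln m)
    <= q * (x / m - 1) + (1 - q) * (m^-1 - 1).
  by rewrite lerD// ler_wpM2l// subr_ge0.
have -> : q * (x / m - 1) + (1 - q) * (m^-1 - 1) = 0.
  transitivity ((1 + q * (x - 1)) / m - 1); first by field; rewrite gt_eqF.
  by rewrite -/m divff ?subrr// gt_eqF.
by lra.
Qed.

Lemma powR_bernoulli_ge x p : 0 < x -> 1 <= p -> 1 + p * (x - 1) <= x `^ p.
Proof.
move=> x0 p1; have p0 : 0 < p by lra.
have [le0|gt0] := leP (1 + p * (x - 1)) 0.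
  by rewrite (le_trans le0)// powR_ge0.
have /= := powR_bernoulli (q := p^-1) gt0.
rewrite invr_ge0 ltW//= invf_le1// p1 => /(_ isT).
have -> : 1 + p^-1 * (1 + p * (x - 1) - 1) = x by field; rewrite gt_eqF.
move=> /(powR_le2r (ltW p0) (powR_ge0 _ _)).
by rewrite -powRrM mulVf ?gt_eqF// powRr1// ltW.
Qed.

Lemma powR_subr1 a p : 0 < a -> a `^ (p - 1) = a `^ p / a.
Proof.
move=> a0; rewrite powRB ?powRr1 ?ltW//.
by rewrite [a == 0]gt_eqF// implybT.
Qed.

Lemma powR_tangent a b p : 0 < a -> 0 < b -> 1 <= p ->
  a `^ p + p * a `^ (p - 1) * (b - a) <= b `^ p.
Proof.
move=> a0 b0 p1.
have := powR_bernoulli_ge (divr_gt0 b0 a0) p1.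
move=> /(ler_wpM2l (powR_ge0 a p)).
have ba0 : 0 <= b / a by rewrite divr_ge0 ?ltW.
rewrite -(powRM _ (ltW a0) ba0) (mulrC a) divfK ?gt_eqF//.
apply: le_trans; rewrite powR_subr1//.
by rewrite le_eqVlt; apply/orP; left; apply/eqP; field; rewrite gt_eqF.
Qed.

(** The concave function [y |-> (y `^ q + g) `^ q^-1] lies below its tangent
    at [v]. Raised to the power [q], the inequality says that a weighted
    mean of [(y / v) `^ q] and [1] is at most the power [q] of the same mean
    of [y / v] and [1], which is Bernoulli's inequality at that mean [m]. *)
Lemma powR_holder_tangent v y g q : 1 <= v -> 1 <= y -> 0 <= g -> 0 < q <= 1 ->
  y `^ q + g <= (v `^ q + g) `^ (1 - q) * (v `^ (q - 1) * y + g) `^ q.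
Proof.
move=> v1 y1 g0 /andP[q0 q1].
have v0 : 0 < v by lra.
have y0 : 0 < y by lra.
pose w := v `^ q; have w0 : 0 < w by exact: powR_gt0.
pose T := w + g; have T0 : 0 < T by rewrite /T; lra.
pose m := (w * (y / v) + g) / T.
have m0 : 0 < m.
  by rewrite divr_gt0// ltr_pwDl// mulr_gt0// divr_gt0.
have mE : w * (y / v) + g = m * T by rewrite /m divfK ?gt_eqF.
clearbody m.
have -> : v `^ (q - 1) * y + g = m * T.
  by rewrite -mE powR_subr1// /w; field; rewrite gt_eqF.
rewrite (powRM _ (ltW m0) (ltW T0)) mulrCA -/w -/T.
rewrite -powRD ?[T == 0]gt_eqF ?implybT// subrK (powRr1 (ltW T0)).
have q01 : 0 <= q <= 1 by rewrite ltW.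
have bern z : 0 < z -> z `^ q <= m `^ q * (1 + q * (z / m - 1)).
  move=> z0; have := powR_bernoulli (divr_gt0 z0 m0) q01.
  move=> /(ler_wpM2l (powR_ge0 m q)).
  rewrite -(powRM _ (ltW m0) (ltW (divr_gt0 z0 m0))).
  by rewrite (mulrC m (z / m)) divfK ?gt_eqF.
have -> : y `^ q = w * (y / v) `^ q.
  rewrite /w -(powRM _ (ltW v0) (ltW (divr_gt0 y0 v0))).
  by rewrite (mulrC v (y / v)) divfK ?gt_eqF.
have {1}-> : g = g * 1 `^ q by rewrite powR1 mulr1.
apply: (le_trans (lerD (ler_wpM2l (ltW w0) (bern _ (divr_gt0 y0 v0)))
  (ler_wpM2l g0 (bern _ ltr01)))).
rewrite le_eqVlt; apply/orP; left; apply/eqP.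
transitivity (m `^ q * ((1 - q) * (w + g) + q * (w * (y / v) + g) / m)).
  by field; rewrite !gt_eqF.
by rewrite mE -/T; congr (_ * _); field; rewrite gt_eqF.
Qed.

(** With [s = a + b - 1], both [a / s] and [b / s] are at most 1, so that
    the power [al <= 1] increases them, and their sum is at least 1. *)
Lemma powR_subadditive a b al : 1 <= a -> 1 <= b -> 0 <= al <= 1 ->
  (a + b - 1) `^ al <= a `^ al + b `^ al.
Proof.
move=> a1 b1 /andP[al0 al1]; set s := a + b - 1.
have s0 : 0 < s by rewrite /s; lra.
have part z : 1 <= z -> z <= s -> z / s * s `^ al <= z `^ al.
  move=> z1 zs; have z0 : 0 < z by lra.
  have zs0 : 0 < z / s by rewrite divr_gt0.
  have -> : z `^ al = (z / s) `^ al * s `^ al.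
    by rewrite -powRM ?(ltW zs0) ?ltW// divfK ?gt_eqF.
  rewrite ler_wpM2r ?powR_ge0// ger1_powR// zs0 ler_pdivrMr// mul1r//.
have pa : a / s * s `^ al <= a `^ al by apply: part; rewrite // /s; lra.
have pb : b / s * s `^ al <= b `^ al by apply: part; rewrite // /s; lra.
apply: le_trans (lerD pa pb); rewrite -mulrDl ler_peMl ?powR_ge0// -mulrDl.
by rewrite ler_pdivlMr// mul1r /s; lra.
Qed.

(** A geometric mean is at most the larger term, hence at most the sum. *)
Lemma powR_interpolation a b xi : 0 <= a -> 0 <= b -> 0 <= xi <= 1 ->
  a `^ xi * b `^ (1 - xi) <= a + b.
Proof.
move=> a0 b0 /andP[xi0 xi1].
wlog ab : a b xi xi0 xi1 a0 b0 / a <= b.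
  move=> H; have [|/ltW ba] := leP a b; first exact: H.
  have := H b a (1 - xi); rewrite subKr mulrC [b + a]addrC; apply=> //; lra.
have xi1' : 0 <= 1 - xi by lra.
apply: (@le_trans _ _ (b `^ xi * b `^ (1 - xi))).
  by rewrite ler_wpM2r ?powR_ge0// powR_le2r.
have [->|b_neq0] := eqVneq b 0.
  rewrite addr0; have [->|xi_neq0] := eqVneq xi 0.
    by rewrite subr0 powRr1// mulr0.
  by rewrite powR0// mul0r.
by rewrite -powRD ?b_neq0 ?implybT// subrKC powRr1//; lra.
Qed.

End power_inequalities.

(** * The polynomial rate and its Lyapunov functions *)

Section polynomial_rate.
Context {R : realType}.
Variables alpha g : R.
Hypotheses (alpha01 : 0 <= alpha < 1) (g0 : 0 < g).
Implicit Types (k : nat) (v y : R).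

Let q : R := 1 - alpha.

Definition poly_rate k : R := (1 + g * k%:R) `^ (alpha / (1 - alpha)).

(** The logarithmic derivative of [poly_rate] in [k], for real [k]. *)
Definition poly_rate_dlog k : R := alpha / (1 - alpha) * g / (1 + g * k%:R).

(** For [phi v = beta * v `^ alpha] and [g = eps_b * beta * (1 - alpha)],
    this is [H^-1 (H v + eps_b * k) - H^-1 (eps_b * k)], where [H] is the
    primitive of [phi^-1] that vanishes at 1: the total rate that a
    deterministic decrease of [V] at speed [eps_b * phi (V)] from [v] to [1]
    collects from time [k] on, times [eps_b * beta]. *)
Definition lyap k v : R :=
  (v `^ (1 - alpha) + g * k%:R) `^ (1 - alpha)^-1
  - (1 + g * k%:R) `^ (1 - alpha)^-1.

Let q_gt0 : 0 < q. Proof. by move: alpha01 => /andP[_]; rewrite /q; lra. Qed.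
Let q_le1 : q <= 1. Proof. by move: alpha01 => /andP[+ _]; rewrite /q; lra. Qed.
Let kappa_ge0 : 0 <= alpha / q.
Proof. by move: alpha01 => /andP[a0 _]; rewrite divr_ge0// ltW. Qed.
Let kappaE : q^-1 - 1 = alpha / q.
Proof.
have -> : alpha = 1 - q by rewrite /q subKr.
by rewrite mulrBl mul1r divff// gt_eqF.
Qed.

Let time_ge0 k : 0 <= g * k%:R. Proof. by rewrite mulr_ge0// ltW. Qed.
Let time_gt0 k : 0 < 1 + g * k%:R. Proof. by rewrite ltr_pwDl. Qed.
Let timeS k : 1 + g * k.+1%:R = 1 + g * k%:R + g.
Proof. by rewrite -natr1; ring. Qed.

Lemma poly_rate_ge1 k : 1 <= poly_rate k.
Proof. by rewrite -(powRr0 (1 + g * k%:R)) ler_powR// lerDl. Qed.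

Lemma poly_rate_dlog_ge0 k : 0 <= poly_rate_dlog k.
Proof. exact: divr_ge0 (mulr_ge0 kappa_ge0 (ltW g0)) (ltW (time_gt0 k)). Qed.

Lemma poly_rate_dlogS k : poly_rate_dlog k.+1 <= poly_rate_dlog k.
Proof.
rewrite /poly_rate_dlog ler_wpM2l//; first exact: mulr_ge0 (ltW g0).
by rewrite lef_pV2 ?posrE// timeS lerDl ltW.
Qed.

Lemma poly_rate_submul k : poly_rate k.+1 <= poly_rate 1 * poly_rate k.
Proof.
rewrite /poly_rate -powRM; [|exact: ltW..].
rewrite powR_le2r//; first exact: ltW.
rewrite timeS mulr1; have := mulr_ge0 (ltW g0) (time_ge0 k).
by move: (time_ge0 k); lra.
Qed.

(** A mean value inequality: the logarithmic derivative is largest at [k],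
    the rate at [k.+1]. *)
Lemma poly_rate_incr k :
  poly_rate k.+1 - poly_rate k <= poly_rate_dlog k * poly_rate k.+1.
Proof.
rewrite /poly_rate /poly_rate_dlog; set a := 1 + g * k%:R.
rewrite timeS -/a; set kap := alpha / (1 - alpha).
have a0 : 0 < a by exact: time_gt0.
have b0 : 0 < a + g by rewrite addr_gt0.
have ab0 : 0 < a / (a + g) by rewrite divr_gt0.
have expge : 1 - kap * g / a <= (a / (a + g)) `^ kap.
  rewrite /powR gt_eqF//; apply: le_trans (expR_ge1Dx _).
  rewrite lerD2l -mulrA -mulrN ler_wpM2l// ln_div ?posrE//.
  have : ln ((a + g) / a) <= (a + g) / a - 1.
    by rewrite ln_le_subr1// divr_gt0.
  rewrite ln_div ?posrE//.
  have -> : (a + g) / a - 1 = g / a by field; rewrite gt_eqF.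
  by lra.
have -> : a `^ kap = (a / (a + g)) `^ kap * (a + g) `^ kap.
  by rewrite -powRM; [rewrite divfK// gt_eqF|exact: ltW..].
have := ler_wpM2r (powR_ge0 (a + g) kap) expge.
by rewrite mulrBl mul1r; lra.
Qed.

Lemma poly_rate_growth k :
  poly_rate k.+1 <= poly_rate k * (1 + poly_rate_dlog k * poly_rate 1).
Proof.
have := ler_wpM2l (poly_rate_dlog_ge0 k) (poly_rate_submul k).
by have := poly_rate_incr k; lra.
Qed.

Lemma lyap_ge0 k v : 1 <= v -> 0 <= lyap k v.
Proof.
move=> v1; have v0 : 0 <= v by lra.
rewrite subr_ge0 powR_le2r ?invr_ge0 ?(ltW q_gt0) ?(ltW (time_gt0 k))//.
by rewrite lerD2r -[leLHS](one_powR q) powR_le2r ?(ltW q_gt0).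
Qed.

Lemma lyap0 v : 1 <= v -> lyap 0 v = v - 1.
Proof.
move=> v1; have v0 : 0 <= v by lra.
by rewrite /lyap mulr0 !addr0 powR1 -powRrM divff ?powRr1// gt_eqF.
Qed.

(** Concavity of [lyap k], with what is needed of its derivative [s] at [v]:
    it is at most the derivative at 1, which is the rate, and it has the
    exact size that lets a decrease of [v] by a multiple of [v `^ alpha]
    compensate for the passage of time. *)
Lemma lyap_tangent k v : 1 <= v -> exists s, [/\ 0 <= s <= poly_rate k,
  s * v `^ alpha = (v `^ (1 - alpha) + g * k%:R) `^ (alpha / (1 - alpha)) &
  forall y, 1 <= y -> lyap k y <= lyap k v + s * (y - v)].
Proof.
move=> v1; have v0 : 0 < v by lra.
rewrite -/q; set T := v `^ q + g * k%:R; set kap := alpha / q.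
have kap0 : 0 <= kap by exact: kappa_ge0.
have vq0 : 0 < v `^ q by exact: powR_gt0.
have va0 : 0 < v `^ (- alpha) by exact: powR_gt0.
have T0 : 0 < T by rewrite ltr_pwDl.
have va : v `^ (- alpha) * v `^ alpha = 1.
  by rewrite powRN mulVf// gt_eqF// powR_gt0.
exists (v `^ (- alpha) * T `^ kap); split.
- rewrite mulr_ge0 ?powR_ge0//=.
  have -> : v `^ (- alpha) = (v `^ (- q)) `^ kap.
    by rewrite -powRrM; congr (_ `^ _); rewrite /kap; field; rewrite gt_eqF.
  rewrite -powRM ?powR_ge0 ?(ltW T0)// /poly_rate -/q -/kap.
  apply: powR_le2r => //; first exact: mulr_ge0 (powR_ge0 _ _) (ltW T0).
  rewrite /T mulrDr powRN mulVf ?gt_eqF// lerD2l ler_piMl//.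
  by rewrite invf_le1// -[leLHS](one_powR q) powR_le2r ?(ltW q_gt0).
- by rewrite mulrAC va mul1r.
move=> y y1; have y0 : 0 < y by lra.
rewrite /lyap -/q addrAC lerD2r.
have qinv : 0 <= q^-1 by rewrite invr_ge0 ltW.
have := @powR_holder_tangent _ v y (g * k%:R) q v1 y1 (time_ge0 k).
rewrite q_gt0 q_le1 => /(_ isT).
move=> /(powR_le2r qinv (addr_ge0 (powR_ge0 _ _) (time_ge0 k))).
have -> : 1 - q = alpha by rewrite /q subKr.
have -> : q - 1 = - alpha by rewrite /q; ring.
have ty0 : 0 <= v `^ (- alpha) * y + g * k%:R.
  exact: addr_ge0 (mulr_ge0 (powR_ge0 _ _) (ltW y0)) (time_ge0 k).
rewrite -/T powRM ?powR_ge0// -[X in _ <= X * _]powRrM -/kap.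
rewrite -[X in _ <= _ * X]powRrM divff ?gt_eqF// powRr1//.
move=> /le_trans; apply; rewrite le_eqVlt; apply/orP; left; apply/eqP.
have -> : T `^ q^-1 = T `^ kap * T.
  have -> : q^-1 = kap + 1 by rewrite /kap -kappaE subrK.
  by rewrite powRD ?[T == 0]gt_eqF ?implybT// powRr1// ltW.
have -> : T = v `^ (- alpha) * v + g * k%:R.
  rewrite /T /q; congr (_ + _); rewrite addrC powRD ?[v == 0]gt_eqF ?implybT//.
  by rewrite powRr1// ltW.
by ring.
Qed.

Lemma lyap_le k v : 1 <= v -> lyap k v <= poly_rate k * (v - 1).
Proof.
move=> v1; have [s [/andP[_ s_le] _ /(_ v v1)]] := @lyap_tangent k 1 (lexx _).
rewrite [lyap k 1]/lyap powR1 subrr add0r => /le_trans; apply.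
by rewrite ler_wpM2r// subr_ge0.
Qed.

(** As time goes from [k] to [k.+1], the first power in [lyap] increases by
    at most what a decrease of [v] by [g / (1 - alpha) * v `^ alpha] takes
    back along the tangent, and the second one by at least a multiple of the
    rate: each is a tangent inequality for the convex power
    [(1 - alpha)^-1]. *)
Lemma lyap_drift k v : 1 <= v -> exists s, [/\ 0 <= s <= poly_rate k.+1,
  forall y, 1 <= y -> lyap k.+1 y <= lyap k.+1 v + s * (y - v) &
  lyap k.+1 v - s * (g / (1 - alpha) * v `^ alpha)
    <= lyap k v - g / (1 - alpha) * poly_rate k].
Proof.
move=> v1; have v0 : 0 < v by lra.
have [s [s01 sE tangent]] := @lyap_tangent k.+1 v v1; exists s; split => //.
rewrite mulrCA sE /lyap /poly_rate -/q; set p := q^-1.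
have p1 : 1 <= p by rewrite invf_ge1.
have T0 : 0 < v `^ q + g * k%:R by rewrite ltr_pwDl// powR_gt0.
have T1 : 0 < v `^ q + g * k.+1%:R by rewrite ltr_pwDl// powR_gt0.
have := powR_tangent T1 T0 p1.
have := powR_tangent (time_gt0 k) (time_gt0 k.+1) p1.
rewrite !kappaE timeS -natr1.
have -> : g / q = p * g by rewrite mulrC.
have -> : v `^ q + g * k%:R - (v `^ q + g * (k%:R + 1)) = - g by ring.
have -> : 1 + g * k%:R + g - (1 + g * k%:R) = g by ring.
by lra.
Qed.

End polynomial_rate.

(** * The rate functions of a power drift *)

Section power_drift.
Context {R : realType}.
Variables alpha beta eps_b : R.
Hypotheses (alpha01 : 0 <= alpha < 1) (beta0 : 0 < beta) (eps_b0 : 0 < eps_b).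

Let phi (v : R) : R := beta * v `^ alpha.
Let q : R := 1 - alpha.
Let q_gt0 : 0 < q. Proof. by move: alpha01 => /andP[_]; rewrite /q; lra. Qed.
Let F (t : R) : R := t `^ q / (beta * q).

Let is_derive_F (t : R) : 0 < t -> is_derive t 1 F (phi t)^-1.
Proof.
move=> t0.
have FE : F = (beta * q)^-1 \*: (powR (R := R) ^~ q).
  by apply/funext => s; rewrite /F /= /GRing.scale/= mulrC.
rewrite FE (_ : (phi t)^-1 = (beta * q)^-1 *: (q * t `^ (q - 1))).
  exact/is_deriveZ/is_derive1_powR.
have tE : t = t `^ q * t `^ alpha.
  by rewrite -powRD ?[t == 0]gt_eqF ?implybT// subrK powRr1// ltW.
rewrite /GRing.scale/= /phi powR_subr1// [X in _ * (_ * (_ / X))]tE.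
by field; rewrite !gt_eqF ?powR_gt0.
Qed.

Lemma H_rate_power t : 1 <= t ->
  H_rate phi t = (t `^ (1 - alpha) - 1) / (beta * (1 - alpha)).
Proof.
rewrite le_eqVlt => /predU1P[<-|t1].
  by rewrite /H_rate set_itv1 Rintegral_set1 powR1 subrr mul0r.
have phi_cont (s : R) : 0 < s -> {for s, continuous (fun s => (phi s)^-1)}.
  move=> s0; apply: continuousV.
    by rewrite gt_eqF// mulr_gt0// powR_gt0.
  apply: continuousM; first exact: cst_continuous.
  by apply: differentiable_continuous; apply/derivable1_diffP/derivable_powR;
     rewrite in_itv/= s0.
have F_cont (s : R) : 0 < s -> {for s, continuous F}.
  move=> s0; apply: differentiable_continuous; apply/derivable1_diffP.
  by case: (is_derive_F s0).
rewrite /H_rate /Rintegral (@continuous_FTC2 _ _ F)//.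
- by rewrite /= /F powR1 mulrBl.
- apply: continuous_in_subspaceT => s; rewrite inE/= in_itv/= => /andP[s1 _].
  by apply: phi_cont; rewrite (lt_le_trans ltr01).
- split.
  + move=> s; rewrite in_itv/= => /andP[s1 _].
    by case: (is_derive_F (lt_trans ltr01 s1)).
  + exact/cvg_at_right_filter/F_cont.
  + by apply/cvg_at_left_filter/F_cont; rewrite (lt_trans ltr01).
- move=> s; rewrite in_itv/= => /andP[s1 _].
  by rewrite derive1E; case: (is_derive_F (lt_trans ltr01 s1)).
Qed.

Lemma H_rate_inv_power u : 0 <= u ->
  H_rate_inv phi u = (1 + beta * (1 - alpha) * u) `^ (1 - alpha)^-1.
Proof.
move=> u0; rewrite -/q; set w := 1 + beta * q * u; set t := w `^ q^-1.
have bq0 : 0 < beta * q by rewrite mulr_gt0.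
have w1 : 1 <= w by rewrite lerDl mulr_ge0// ltW.
have qinv0 : 0 <= q^-1 by rewrite invr_ge0 ltW.
have t1 : 1 <= t by rewrite -(one_powR q^-1) powR_le2r.
have Ht : H_rate phi t = u.
  rewrite H_rate_power// -/q -powRrM mulVf ?gt_eqF// powRr1; last by lra.
  by rewrite /w addrAC subrr add0r mulrAC divff ?mul1r// gt_eqF.
rewrite -Ht /H_rate_inv pinvKV//; last by rewrite inE.
move=> a b; rewrite !inE/= => a1 b1; rewrite !H_rate_power// -/q.
have bqV : (beta * q)^-1 != 0 by rewrite invr_neq0// gt_eqF.
move=> /(mulIf bqV) /addIr /(congr1 (powR (R := R) ^~ q^-1)).
by rewrite -!powRrM divff ?gt_eqF// !powRr1//; lra.
Qed.

Let g : R := eps_b * beta * (1 - alpha).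
Let Hn n : H_rate_inv phi (eps_b * n%:R) = (1 + g * n%:R) `^ (1 - alpha)^-1.
Proof.
rewrite H_rate_inv_power ?mulr_ge0 ?(ltW eps_b0)//.
by congr ((1 + _) `^ _); rewrite /g; ring.
Qed.
Let time_gt0 n : 0 < 1 + g * n%:R.
Proof.
by rewrite ltr_pwDl// !mulr_ge0 ?(ltW eps_b0) ?(ltW beta0) ?(ltW q_gt0).
Qed.

Lemma r_rate_power n : r_rate phi eps_b n = poly_rate alpha g n.
Proof.
rewrite /r_rate Hn /phi powR1 mulr1 mulrAC divff ?gt_eqF// mul1r.
by rewrite -powRrM [(1 - alpha)^-1 * alpha]mulrC.
Qed.

Lemma delta_rate_power k : delta_rate phi eps_b k = poly_rate_dlog alpha g k.
Proof.
rewrite /delta_rate Hn; set t := _ `^ _.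
have t0 : 0 < t by rewrite powR_gt0.
have -> : derive1 phi t = beta * (alpha * t `^ (alpha - 1)).
  have phiE : phi = beta \*: (powR (R := R) ^~ alpha) by [].
  rewrite phiE derive1E; have [_ ->//] : is_derive t 1
    (beta \*: (powR (R := R) ^~ alpha)) (beta *: (alpha * t `^ (alpha - 1))).
  exact/is_deriveZ/is_derive1_powR.
have -> : alpha - 1 = - q by rewrite /q; ring.
rewrite powRN -powRrM mulVf ?gt_eqF// powRr1 ?(ltW (time_gt0 k))//.
by rewrite /poly_rate_dlog /g -/q; field; rewrite !gt_eqF.
Qed.

End power_drift.

(** * Series of products and finiteness of the constant *)

Section product_series.
Context {R : realType}.
Variable a : nat -> R.

Definition prod_series k m : R := \sum_(i < m) \prod_(k <= l < k + i) a l.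

Lemma prod_series0 k : prod_series k 0 = 0.
Proof. by rewrite /prod_series big_ord0. Qed.

Lemma prod_seriesS k m : prod_series k m.+1 = 1 + a k * prod_series k.+1 m.
Proof.
rewrite /prod_series big_ord_recl/= addn0 big_geq//; congr (_ + _).
rewrite big_distrr/=; apply: eq_bigr => i _.
by rewrite /bump/= add1n big_ltn ?addnS ?addSn// ltnS leq_addr.
Qed.

Hypothesis a_ge0 : forall k, 0 <= a k.

Lemma prod_series_ge0 k m : 0 <= prod_series k m.
Proof. by apply: sumr_ge0 => i _; apply: prodr_ge0. Qed.

Lemma prod_series_mono k m : prod_series k m <= prod_series k m.+1.
Proof.
elim: m k => [|m IH] k; first by rewrite prod_series0 prod_series_ge0.
by rewrite [leLHS]prod_seriesS prod_seriesS lerD2l ler_wpM2l.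
Qed.

Hypothesis a_dec : forall k, a k.+1 <= a k.

Lemma prod_series_shift k m : prod_series k.+1 m <= prod_series k m.
Proof.
elim: m k => [|m IH] k; first by rewrite !prod_series0.
by rewrite !prod_seriesS lerD2l ler_pM// prod_series_ge0.
Qed.

(** From the rank [N] on, the sums are at most the sum of the geometric
    series of ratio [q]; the ranks from [k] to [N] are then peeled off one
    at a time. *)
Lemma prod_series_bounded q N k : q < 1 -> a N <= q ->
  exists B, forall m, prod_series k m <= B.
Proof.
move=> q1 aN.
have q0 : 0 <= q := le_trans (a_ge0 N) aN.
have geom j m : (N <= j)%N -> prod_series j m <= (1 - q)^-1.
  have -> : (1 - q)^-1 = 1 + q * (1 - q)^-1 by field; lra.
  have q10 : 0 <= (1 - q)^-1 by rewrite invr_ge0; lra.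
  elim: m j => [|m IH] j Nj.
    by rewrite prod_series0 addr_ge0// mulr_ge0.
  rewrite prod_seriesS lerD2l ler_pM// ?prod_series_ge0//.
    apply: le_trans aN; rewrite -(subnK Nj).
    by elim: (j - N)%N => // n; apply: le_trans; rewrite addSn.
  apply: (le_trans (IH _ (leqW Nj))).
  by have -> : 1 + q * (1 - q)^-1 = (1 - q)^-1 by field; lra.
suff peel n j : (N <= j + n)%N -> exists B, forall m, prod_series j m <= B.
  exact: (peel N k (leq_addl _ _)).
elim: n j => [|n IH] j Nj.
  by rewrite addn0 in Nj; exists (1 - q)^-1 => m; exact: geom.
have [|B HB] := IH j.+1; first by rewrite addSn -addnS.
exists (1 + a j * B) => m.
apply: (le_trans (prod_series_mono _ _)).
by rewrite prod_seriesS lerD2l ler_wpM2l.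
Qed.

End product_series.

Section visits_series.
Context {R : realType}.
Variables (phi : R -> R) (eps_nu eps_b b_V c_V : R).

Local Notation delta := (delta_rate phi eps_b).
Local Notation M1 := (M1_const phi eps_nu eps_b b_V c_V).
Local Notation cstar := (cstar_const phi eps_nu eps_b b_V c_V).

(** Factor gained by the expected rate between two visits of the pair to
    [C `*` C], times the probability of not coupling at the first of them. *)
Definition visit_factor k : R := (1 - eps_nu) * (1 + delta k * M1).

Lemma cstar_partial n :
  (\sum_(1 <= j < n.+1) ((1 - eps_nu) ^+ j.-1 *
      \prod_(1 <= k < j) (1 + delta k * M1))%:E)%E
  = (prod_series visit_factor 1 n)%:E.
Proof.
rewrite big_add1/= sumEFin /prod_series big_mkord; congr EFin.
apply: eq_bigr => i _; rewrite [RHS]big_split/= add1n; congr (_ * _).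
by rewrite big_const_nat/= subn1 -iter_mulr_1.
Qed.

Hypotheses (eps_nu01 : 0 < eps_nu < 1) (M1_ge0 : 0 <= M1).
Hypotheses (delta_ge0 : forall k, 0 <= delta k)
  (delta_dec : forall k, delta k.+1 <= delta k).

Lemma visit_factor_ge0 k : 0 <= visit_factor k.
Proof.
move: eps_nu01 => /andP[_ e1].
by rewrite mulr_ge0 ?subr_ge0 ?ltW// ltr_wpDr// mulr_ge0.
Qed.

Lemma visit_factorS k : visit_factor k.+1 <= visit_factor k.
Proof.
move: eps_nu01 => /andP[_ e1].
by rewrite ler_wpM2l ?subr_ge0 ?(ltW e1)// lerD2l ler_wpM2r.
Qed.

Let term_ge0 j : (0 <= ((1 - eps_nu) ^+ j.-1 *
      \prod_(1 <= k < j) (1 + delta k * M1))%:E)%E.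
Proof.
move: eps_nu01 => /andP[_ e1].
rewrite lee_fin mulr_ge0 ?exprn_ge0 ?subr_ge0 ?(ltW e1)//.
by apply: prodr_ge0 => k _; rewrite addr_ge0// mulr_ge0.
Qed.

Lemma prod_series_le_cstar n :
  ((prod_series visit_factor 1 n)%:E <= cstar)%E.
Proof. by rewrite -cstar_partial; apply: nneseries_lim_ge. Qed.

(** From the time [N] on, the ratio of consecutive terms is at most
    [1 - eps_nu ^+ 2 < 1]. *)
Lemma cstar_fin_num : (exists N, delta N * M1 <= eps_nu) ->
  cstar \is a fin_num.
Proof.
move=> [N HN]; move: (eps_nu01) => /andP[e0 e1].
have [||B HB] := @prod_series_bounded _ visit_factor visit_factor_ge0
  visit_factorS (1 - eps_nu ^+ 2) N 1%N.
- by rewrite ltrBlDr ltrDl exprn_gt0.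
- have -> : 1 - eps_nu ^+ 2 = (1 - eps_nu) * (1 + eps_nu) by ring.
  by rewrite ler_wpM2l ?subr_ge0 ?(ltW e1)// lerD2l.
rewrite ge0_fin_numE; last exact: nneseries_ge0.
apply: (@le_lt_trans _ _ B%:E); last exact: ltry.
apply: lime_le; first exact: is_cvg_nneseries.
near=> n; have n0 : (0 < n)%N by near: n; exists 1%N.
by rewrite -(prednK n0) cstar_partial lee_fin.
Unshelve. all: by end_near. Qed.

End visits_series.

(** * Coupling of two means *)

Section coupling.
Context d (X : measurableType d) (R : realType).
Implicit Types (mu : {measure set X -> \bar R}) (nu : probability X R).
Implicit Types (f h V : X -> R).

Lemma ge0_integral_minorised mu nu (e : R) f : 0 <= e ->
  (forall A, measurable A -> (e%:E * nu A <= mu A)%E) ->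
  measurable_fun setT f -> (forall x, 0 <= f x) ->
  (e%:E * \int[nu]_x (f x)%:E <= \int[mu]_x (f x)%:E)%E.
Proof.
move=> e0 min mf f0.
have mf' : measurable_fun setT (fun x => (f x)%:E) by exact/measurable_EFinP.
rewrite -(@ge0_integral_mscale _ _ _ _ _ measurableT (NngNum e0)
  (fun x => (f x)%:E))//.
  by apply: ge0_le_measure_integral.
by move=> x _; rewrite lee_fin.
Qed.

Lemma integral_affine mu (h V : X -> R) : mu setT = 1%E ->
  mu.-integrable setT (EFin \o V) -> mu.-integrable setT (EFin \o h) ->
  forall a b c : R, (\int[mu]_x (a + b * h x + c * V x)%:E)%E
    = (a + b * \int[mu]_x h x + c * \int[mu]_x V x)%:E.
Proof.
move=> mu1 iV ih a b c.
have ia : mu.-integrable setT (EFin \o cst a).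
  apply/integrableP; split; first exact/measurable_EFinP/measurable_cst.
  by rewrite (eq_integral (cst `|a|%:E))// integral_cst// mu1 mule1 ltry.
have ib : mu.-integrable setT (EFin \o (fun x => b * h x)).
  exact: (integrableZl _ _ ih).
have ic : mu.-integrable setT (EFin \o (fun x => c * V x)).
  exact: (integrableZl _ _ iV).
have iab : mu.-integrable setT (EFin \o (fun x => a + b * h x)).
  exact: (integrableD _ ia ib).
rewrite -[LHS]fineK; last exact: (integrable_fin_num _ (integrableD _ iab ic)).
congr EFin; rewrite -[LHS]/(\int[mu]_x (a + b * h x + c * V x)).
by rewrite RintegralD// RintegralD// !RintegralZl// Rintegral_cst// mu1 mulr1.
Qed.

(** A function whose oscillation is controlled by [a + b * (V y + V y')] has
    means under [mu] and [mu'] that differ by at most the mean of that bound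
    under any coupling; the bound being a sum of a function of [y] and one
    of [y'], no coupling has to be built. The inequality
    [h y - b * V y <= a + h y' + b * V y'] for all [y] and [y'] is separated
    by a constant [m], and the two nonnegative differences thus obtained are
    at least [e] times their means under [nu]: this is where the common part
    of [mu] and [mu'] is saved. *)
Lemma mean_diff_minorised mu mu' nu (e a b : R) h V :
  mu setT = 1%E -> mu' setT = 1%E -> 0 <= e -> 0 <= b ->
  (forall A, measurable A -> (e%:E * nu A <= mu A)%E) ->
  (forall A, measurable A -> (e%:E * nu A <= mu' A)%E) ->
  measurable_fun setT V -> measurable_fun setT h -> (forall x, 1 <= V x) ->
  mu.-integrable setT (EFin \o V) -> mu'.-integrable setT (EFin \o V) ->
  mu.-integrable setT (EFin \o h) -> mu'.-integrable setT (EFin \o h) ->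
  (forall y y', h y - h y' <= a + b * (V y + V y')) ->
  \int[mu]_x h x - \int[mu']_x h x <=
    (1 - e) * a + b * (\int[mu]_x V x + \int[mu']_x V x - 2 * e).
Proof.
move=> mu1 mu'1 e0 b0 min min' mV mh V1 iV iV' ih ih' osc.
pose u y := h y - b * V y; pose w y := a + h y + b * V y.
have uw y y' : u y <= w y' by rewrite /u /w; have := osc y y'; lra.
have mbV : measurable_fun setT (fun x => b * V x) by exact: measurable_funM.
have mu_ : measurable_fun setT u by exact: measurable_funB.
have mw : measurable_fun setT w.
  by apply: measurable_funD => //; exact: measurable_funD.
have [x0 _] : [set: X] !=set0.
  apply/set0P/eqP => X0; move: mu1; rewrite X0 measure0 => /eqP.
  by rewrite eq_sym onee_eq0.
have u_ub : has_sup (range u).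
  by split; [exists (u x0), x0|exists (w x0) => _ [y _ <-]].
pose m := sup (range u).
have um y : 0 <= m - u y by rewrite subr_ge0 sup_upper_bound//; exists y.
have mw_ y : 0 <= w y - m.
  by rewrite subr_ge0 ge_sup//; [exists (u x0), x0|move=> _ [z _ <-]].
have mmu : measurable_fun setT (fun x => m - u x) by exact: measurable_funB.
have mmw : measurable_fun setT (fun x => w x - m) by exact: measurable_funB.
have low : ((e * (a + 2 * b))%:E
    <= e%:E * \int[nu]_x (m - u x)%:E + e%:E * \int[nu]_x (w x - m)%:E)%E.
  have sum0 : (0 <= \int[nu]_x (m - u x)%:E + \int[nu]_x (w x - m)%:E)%E.
    by apply: adde_ge0; apply: integral_ge0 => x _; rewrite lee_fin.
  rewrite -muleDr//; last first.
    by apply: ge0_adde_def; rewrite inE; apply: integral_ge0 => x _;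
      rewrite lee_fin.
  have [neg|pos] := ltP (a + 2 * b) 0.
    apply: (@le_trans _ _ 0%E); last by rewrite mule_ge0// lee_fin.
    by rewrite lee_fin mulr_ge0_le0// ltW.
  rewrite EFinM lee_wpmul2l ?lee_fin//.
  rewrite -ge0_integralD//=; last 4 first.
  - by move=> x _; rewrite lee_fin.
  - exact/measurable_EFinP.
  - by move=> x _; rewrite lee_fin.
  - exact/measurable_EFinP.
  have <- : (\int[nu]_x (a + 2 * b)%:E)%E = (a + 2 * b)%:E.
    by rewrite integral_cst// -[RHS]mule1; congr *%E; exact: probability_setT.
  apply: ge0_le_integral => //=.
  - by apply/measurable_EFinP/measurable_funD.
  - move=> x _; rewrite lee_fin /u /w.
    have : 2 * b <= 2 * b * V x by rewrite ler_peMr// mulr_ge0.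
    by lra.
have := le_trans low (leeD (ge0_integral_minorised e0 min mmu um)
             (ge0_integral_minorised e0 min' mmw mw_)).
rewrite (@eq_integral _ _ _ mu _ (fun x => (m + (-1) * h x + b * V x)%:E));
  last by move=> x _; congr EFin; rewrite /u; ring.
rewrite (@eq_integral _ _ _ mu' _ (fun x => ((a - m) + 1 * h x + b * V x)%:E));
  last by move=> x _; congr EFin; rewrite /w; ring.
by rewrite !integral_affine// -EFinD lee_fin; lra.
Qed.

End coupling.

(** * Products of kernels on weighted functions *)

Section weighted_functions.
Context d (X : measurableType d) (R : realType).
Variable V : X -> R.
Hypotheses (mV : measurable_fun setT V) (V_ge1 : forall x, 1 <= V x).
Implicit Types (f h : X -> R).

Definition weight_bounded h :=
  measurable_fun setT h /\ exists c, forall x, `|h x| <= c * V x.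

Lemma weight_bounded0 : weight_bounded (fun=> 0).
Proof. by split=> //; exists 0 => x; rewrite normr0 mul0r. Qed.

Lemma weight_boundedD f h : weight_bounded f -> weight_bounded h ->
  weight_bounded (fun x => f x + h x).
Proof.
move=> [mf [c Hc]] [mh [c' Hc']]; split; first exact: measurable_funD.
exists (c + c') => x; rewrite mulrDl.
by rewrite (le_trans (ler_normD _ _))// lerD.
Qed.

Lemma weight_bounded_integrable (mu : {measure set X -> \bar R}) h :
  mu.-integrable setT (EFin \o V) -> weight_bounded h ->
  mu.-integrable setT (EFin \o h).
Proof.
move=> iV [mh [c Hc]].
apply: (le_integrable measurableT _ _ (integrableZl measurableT c iV)).
  exact/measurable_EFinP.
by move=> x _ /=; rewrite lee_fin (le_trans (Hc x))// ler_norm.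
Qed.

Lemma ge0_integrable_weight (mu : {measure set X -> \bar R}) :
  (\int[mu]_x (V x)%:E < +oo)%E -> mu.-integrable setT (EFin \o V).
Proof.
move=> fin; apply/integrableP; split; first exact/measurable_EFinP.
rewrite (eq_integral (EFin \o V))// => x _ /=.
by rewrite ger0_norm// (le_trans ler01).
Qed.

End weighted_functions.

Section kernel_products.
Context d (X : measurableType d) (R : realType).
Variables (P : nat -> R.-pker X ~> X) (V : X -> R) (b : R).
Hypotheses (mV : measurable_fun setT V) (V_ge1 : forall x, 1 <= V x).
Hypothesis b_ge0 : 0 <= b.
Hypothesis drift : forall k x, (0 < k)%N ->
  (\int[P k x]_y (V y)%:E <= (V x + b)%:E)%E.
Implicit Types (f h : X -> R).

Let V_ge0 x : 0 <= V x. Proof. exact: le_trans (V_ge1 x). Qed.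
Let mVE : measurable_fun setT (fun x => (V x)%:E).
Proof. exact/measurable_EFinP. Qed.

Lemma kernel_integrable_weight k x : (0 < k)%N ->
  (P k x).-integrable setT (EFin \o V).
Proof.
move=> k0; apply: ge0_integrable_weight => //.
exact: le_lt_trans (drift x k0) (ltry _).
Qed.

Lemma kernel_mean_weight k x : (0 < k)%N -> \int[P k x]_y V y <= V x + b.
Proof.
move=> k0; rewrite -lee_fin fineK ?drift//.
exact: integrable_fin_num (kernel_integrable_weight x k0).
Qed.

(** Adding a multiple of [V] to [h] reduces measurability to the case of a
    nonnegative function. *)
Lemma weight_bounded_kernel k h : (0 < k)%N -> weight_bounded V h ->
  weight_bounded V (fun x => \int[P k x]_y h y).
Proof.
move=> k0 bh; have [mh [c Hc]] := bh.
have iV x := kernel_integrable_weight x k0.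
have ih x := weight_bounded_integrable (iV x) bh.
have icV x : (P k x).-integrable setT (EFin \o (fun y => c * V y)).
  exact: (integrableZl _ _ (iV x)).
have mfine (u : X -> R) : measurable_fun setT u -> (forall y, 0 <= u y) ->
    measurable_fun setT (fun x => \int[P k x]_y u y).
  move=> mu_ u0; apply: measurableT_comp; first exact: fine_measurable.
  apply: measurable_fun_integral_kernel => [U mU|y|].
  - exact: measurable_kernel.
  - by rewrite lee_fin.
  - exact/measurable_EFinP.
have c0 y : 0 <= h y + c * V y.
  by have := Hc y; rewrite ler_norml => /andP[]; lra.
split.
  rewrite (_ : (fun x => _) = (fun x =>
    \int[P k x]_y (h y + c * V y) - c * \int[P k x]_y V y)); last first.
    apply/funext => x; rewrite RintegralD// RintegralZl//; first by ring.
  apply: measurable_funB.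
    by apply: mfine => //; apply: measurable_funD => //; exact: measurable_funM.
  by apply: measurable_funM => //; exact: mfine.
exists (`|c| * (1 + b)) => x.
apply: (le_trans (le_normr_Rintegral measurableT (ih x))).
apply: (@le_trans _ _ (\int[P k x]_y (`|c| * V y))).
  apply: le_Rintegral => //.
  - exact: integrable_norm.
  - exact: (integrableZl _ _ (iV x)).
  - by move=> y _; rewrite (le_trans (Hc y))// ler_wpM2r// ler_norm.
rewrite RintegralZl// -mulrA ler_wpM2l//.
rewrite (le_trans (kernel_mean_weight x k0))// mulrDl mul1r lerD2l.
by rewrite ler_peMr.
Qed.

Lemma ge0_integral_kernel_prodS n x h : measurable_fun setT h ->
  (forall y, 0 <= h y) ->
  (\int[kernel_prod P n.+1 x]_z (h z)%:E
   = \int[kernel_prod P n x]_y \int[P n.+1 y]_z (h z)%:E)%E.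
Proof.
move=> mh h0.
(* the composition is that of a kernel that ignores its first argument *)
rewrite -(@integral_kcomp _ _ _ X X X R (kernel_prod P n)
  (kernel.kernel_snd (P n.+1)) x
  (fun z => (h z)%:E))//; last exact/measurable_EFinP.
Qed.

Lemma kernel_prod_integrable_weight n x :
  (kernel_prod P n x).-integrable setT (EFin \o V).
Proof.
apply: ge0_integrable_weight => //.
elim: n => [|n IH] /=.
  by rewrite integral_dirac// diracT mul1e ltry.
rewrite [ltLHS]ge0_integral_kernel_prodS//.
apply: (@le_lt_trans _ _ (\int[kernel_prod P n x]_y (V y + b)%:E)%E).
  apply: ge0_le_integral => //.
  - by move=> y _; apply: integral_ge0 => z _; rewrite lee_fin.
  - apply: measurable_fun_integral_kernel => // U mU.
    exact: measurable_kernel.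
  - by apply/measurable_EFinP; exact: measurable_funD.
  - by move=> y _; exact: drift.
under eq_integral do rewrite EFinD.
rewrite ge0_integralD//=; [|by move=> y _; rewrite lee_fin..].
rewrite lte_add_pinfty// integral_cst//.
apply: (@le_lt_trans _ _ (b%:E * 1)%E); last by rewrite mule1 ltry.
by rewrite lee_wpmul2l ?lee_fin//; exact: sprob_kernel_le1.
Qed.

(** Again the case of nonnegative functions, applied to [h + c * V] and [V]. *)
Lemma mean_kernel_prodS n x h : weight_bounded V h ->
  \int[kernel_prod P n.+1 x]_z h z
  = \int[kernel_prod P n x]_y (\int[P n.+1 y]_z h z).
Proof.
move=> bh; have [mh [c Hc]] := bh.
have iV m := kernel_prod_integrable_weight m x.
have iVP y := kernel_integrable_weight y (ltn0Sn n).
have ih m := weight_bounded_integrable (iV m) bh.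
have ihP y := weight_bounded_integrable (iVP y) bh.
have mcV : measurable_fun setT (fun y => c * V y) by exact: measurable_funM.
have bcV : weight_bounded V (fun y => c * V y).
  by split=> //; exists `|c| => y; rewrite normrM (ger0_norm (V_ge0 y)).
have ge0E u : weight_bounded V u -> (forall y, 0 <= u y) ->
    \int[kernel_prod P n.+1 x]_z u z
    = \int[kernel_prod P n x]_y (\int[P n.+1 y]_z u z).
  move=> bu u0; rewrite /Rintegral ge0_integral_kernel_prodS//; last first.
    exact: bu.1.
  congr fine; apply: eq_integral => y _ /=; rewrite fineK//.
  exact: integrable_fin_num (weight_bounded_integrable (iVP y) bu).
have icV m : (kernel_prod P m x).-integrable setT (EFin \o (fun y => c * V y)).
  exact: weight_bounded_integrable.
have icVP y : (P n.+1 y).-integrable setT (EFin \o (fun y => c * V y)).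
  exact: weight_bounded_integrable.
have bhP := weight_bounded_kernel (ltn0Sn n) bh.
have bcVP := weight_bounded_kernel (ltn0Sn n) bcV.
have := ge0E (fun y => h y + c * V y) (weight_boundedD bh bcV).
have c0 y : 0 <= h y + c * V y.
  by have := Hc y; rewrite ler_norml => /andP[]; lra.
move=> /(_ c0); rewrite RintegralD//.
under [X in _ = X -> _]eq_Rintegral do rewrite RintegralD//.
rewrite RintegralD//; [|exact: weight_bounded_integrable..].
suff -> : \int[kernel_prod P n.+1 x]_z (c * V z) =
    \int[kernel_prod P n x]_y (\int[P n.+1 y]_z (c * V z)) by move/addIr.
have bV : weight_bounded V V.
  by split=> //; exists 1 => y; rewrite mul1r ger0_norm.
rewrite RintegralZl// ge0E//.
under [RHS]eq_Rintegral do rewrite RintegralZl//.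
rewrite RintegralZl//.
exact: weight_bounded_integrable (weight_bounded_kernel (ltn0Sn n) bV).
Qed.

(** The expected sum of the [m] values [f k], [f k.+1], and so on, along the
    chain started at time [k]. The products of kernels compose on the right,
    whereas coupling acts on the first step: this recursion exposes that
    step. *)
Fixpoint backward_sum (f : nat -> X -> R) m k : X -> R :=
  match m with
  | 0 => fun=> 0
  | m'.+1 => fun x => f k x + \int[P k.+1 x]_y backward_sum f m' k.+1 y
  end.

Lemma backward_sum_bounded (f : nat -> X -> R) m k :
  (forall n, weight_bounded V (f n)) -> weight_bounded V (backward_sum f m k).
Proof.
move=> bf; elim: m k => [|m IH] k /=; first exact: weight_bounded0.
by apply: weight_boundedD => //; exact: weight_bounded_kernel.
Qed.

Lemma mean_backward_sum (f : nat -> X -> R) m k x :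
  (forall n, weight_bounded V (f n)) ->
  \int[kernel_prod P k x]_y backward_sum f m k y
  = \sum_(i < m) \int[kernel_prod P (k + i)%N x]_y f (k + i)%N y.
Proof.
move=> bf; elim: m k => [|m IH] k.
  by rewrite big_ord0 /= Rintegral_cst// mul0r.
have bb := backward_sum_bounded m k.+1 bf.
rewrite big_ord_recl/= addn0 RintegralD//.
- rewrite -mean_kernel_prodS// IH; congr (_ + _).
  by apply: eq_bigr => i _; rewrite /bump/= add1n addSn addnS.
- exact: weight_bounded_integrable (kernel_prod_integrable_weight k x) (bf k).
- apply: (weight_bounded_integrable (kernel_prod_integrable_weight k x)).
  exact: weight_bounded_kernel.
Qed.

Lemma backward_sumE (f : nat -> X -> R) m x :
  (forall n, weight_bounded V (f n)) ->
  backward_sum f m 0 x = \sum_(i < m) \int[kernel_prod P i x]_y f i y.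
Proof.
move=> bf; rewrite -(mean_backward_sum m 0 x bf) /Rintegral /=.
have [mb _] := backward_sum_bounded m 0 bf.
rewrite integral_dirac//; last exact/measurable_EFinP.
by rewrite diracT mul1e.
Qed.

End kernel_products.

(** * The Lyapunov function of the pair of chains *)

Section pair_lyapunov.
Context {R : realType}.
Variables alpha beta eps_b eps_nu b_V c_V : R.
Hypotheses (alpha01 : 0 <= alpha < 1) (beta0 : 0 < beta).
Hypotheses (eps_b01 : 0 < eps_b < 1) (eps_nu01 : 0 < eps_nu < 1).
Hypotheses (b_V_gt0 : 0 < b_V) (c_V_ge1 : 1 <= c_V).

Let phi (v : R) : R := beta * v `^ alpha.
Let g : R := eps_b * beta * (1 - alpha).
Let E : R := eps_b * beta.
Local Notation r := (poly_rate alpha g).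
Local Notation delta := (poly_rate_dlog alpha g).
Local Notation factor := (visit_factor phi eps_nu eps_b b_V c_V).

Let eb0 : 0 < eps_b. Proof. by case/andP: eps_b01. Qed.
Let en0 : 0 < eps_nu. Proof. by case/andP: eps_nu01. Qed.
Let en1 : 0 < 1 - eps_nu. Proof. by case/andP: eps_nu01 => _; lra. Qed.
Let q0 : 0 < 1 - alpha. Proof. by case/andP: alpha01 => _; lra. Qed.
Let E0 : 0 < E. Proof. exact: mulr_gt0. Qed.
Let g0 : 0 < g. Proof. exact: mulr_gt0. Qed.
Let gE : g / (1 - alpha) = E. Proof. by rewrite /g mulfK// gt_eqF. Qed.
Let r_ge1 k : 1 <= r k. Proof. exact: poly_rate_ge1. Qed.
Let r_ge0 k : 0 <= r k. Proof. exact: le_trans (r_ge1 k). Qed.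
Let delta_ge0 k : 0 <= delta k. Proof. exact: poly_rate_dlog_ge0. Qed.

Lemma M1_power : M1_const phi eps_nu eps_b b_V c_V
  = r 1 * (1 + 2 * r 1 / E * ((b_V + c_V) / (1 - eps_nu) - 1)).
Proof. by rewrite /M1_const r_rate_power// /phi powR1 mulr1. Qed.

Lemma M1_power_ge0 : 0 <= M1_const phi eps_nu eps_b b_V c_V.
Proof.
rewrite M1_power mulr_ge0// addr_ge0// mulr_ge0//.
  by rewrite divr_ge0 ?mulr_ge0// ltW.
by rewrite subr_ge0 ler_pdivlMr// mul1r; move: en0 b_V_gt0 c_V_ge1; lra.
Qed.

Let delta_rate_ge0 k : 0 <= delta_rate phi eps_b k.
Proof. by rewrite delta_rate_power. Qed.

Let delta_rateS k : delta_rate phi eps_b k.+1 <= delta_rate phi eps_b k.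
Proof. by rewrite !delta_rate_power// poly_rate_dlogS. Qed.

Let factor_ge0 k : 0 <= factor k.
Proof. exact: visit_factor_ge0 eps_nu01 M1_power_ge0 delta_rate_ge0 k. Qed.

Let factorS k : factor k.+1 <= factor k.
Proof. exact: visit_factorS eps_nu01 M1_power_ge0 delta_rateS k. Qed.

Lemma cstar_power_fin_num :
  cstar_const phi eps_nu eps_b b_V c_V \is a fin_num.
Proof.
have M0 := M1_power_ge0; set M1 := M1_const _ _ _ _ _ in M0.
apply: (cstar_fin_num eps_nu01 M0 delta_rate_ge0 delta_rateS).
have kap0 : 0 <= alpha / (1 - alpha).
  by case/andP: alpha01 => a0 _; rewrite divr_ge0// ltW.
pose B := alpha / (1 - alpha) * M1 / eps_nu.
have B0 : 0 <= B by exact: divr_ge0 (mulr_ge0 kap0 M0) (ltW en0).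
(* delta decreases to 0 as the inverse of time *)
exists (Num.bound B); rewrite delta_rate_power// -/g -/M1 /poly_rate_dlog.
set n := Num.bound B; have Bn : B < n%:R.
  by have := archi_boundP B0.
have t0 : 0 < 1 + g * n%:R by rewrite ltr_pwDl// mulr_ge0// ltW.
rewrite mulrAC ler_pdivrMr// mulrAC.
have -> : alpha / (1 - alpha) * M1 * g = B * eps_nu * g.
  by rewrite /B divfK// gt_eqF.
have := mulr_gt0 en0 g0 => eg0.
have : eps_nu * g * B <= eps_nu * g * n%:R by rewrite ler_pM2l// ltW.
by move: en0; lra.
Qed.

(** From [v] at time [k], the rate one step after the next visit to
    [C `*` C] exceeds [r k.+1] by at most [lambda k * lyap alpha g k v] in
    the mean. *)
Let lambda k : R := r 1 ^+ 2 * delta k / E.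

Let lambda_ge0 k : 0 <= lambda k.
Proof.
exact: divr_ge0 (mulr_ge0 (exprn_ge0 2 (r_ge0 1)) (delta_ge0 k)) (ltW E0).
Qed.

Let lambdaS k : lambda k.+1 <= lambda k.
Proof.
rewrite ler_wpM2r ?invr_ge0 ?(ltW E0)//.
by rewrite ler_wpM2l ?exprn_ge0// poly_rate_dlogS.
Qed.

Let rate_excursion k : r k.+2 - r k.+1 <= lambda k.+1 * E * r k.
Proof.
apply: (le_trans (poly_rate_incr alpha01 g0 k.+1)).
rewrite /lambda divfK ?gt_eqF//.
have -> : r 1 ^+ 2 * delta k.+1 * r k = delta k.+1 * (r 1 * (r 1 * r k)).
  by ring.
apply: ler_wpM2l => //; apply: (le_trans (poly_rate_submul alpha01 g0 k.+1)).
by apply: ler_wpM2l => //; exact: poly_rate_submul.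
Qed.

(** The rate is counted one step after each visit to [C `*` C]: [r k] for a
    visit at the time before [k], and then [r k.+1] plus the growth during
    the excursion that starts at time [k]. There the mean of
    [V x + V x' - 2], on the event that the chains have not met, is at most
    [2 * c_V + 2 * b_V - 2], and [lambda] converts it into an increase of
    the rate. Given that event, [1 + delta k * M1] bounds the factor between
    the two visits. *)
Let rate_visit k : (1 - eps_nu) * r k.+1
    + lambda k * r k * (2 * c_V + 2 * b_V - 2) <= factor k * r k.
Proof.
rewrite /visit_factor delta_rate_power// M1_power -/g -/phi.
have growth := ler_wpM2l (ltW en1) (poly_rate_growth alpha01 g0 k).
apply: le_trans (lerD growth (lexx _)) _.
set x := _ / (1 - eps_nu) - 1.
have -> : (1 - eps_nu) * (1 + delta k * (r 1 * (1 + 2 * r 1 / E * x))) * r k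
  = (1 - eps_nu) * (r k * (1 + delta k * r 1))
    + lambda k * r k * (2 * ((1 - eps_nu) * x)).
  by rewrite /lambda; field; rewrite gt_eqF.
rewrite lerD2l; apply: ler_wpM2l; first exact: mulr_ge0.
have -> : (1 - eps_nu) * x = b_V + c_V - (1 - eps_nu).
  by rewrite /x mulrBr mulr1 mulrC divfK// gt_eqF.
by move: en0; lra.
Qed.

Let D : R := 2 * b_V / E.
Let A m k : R := prod_series factor k m.

(** Bounds, for [v = V x + V x' - 1], the expected sum of twice the rate
    plus [V `^ alpha] for both chains over the next [m] times, as long as
    they are not coupled. The two terms before the last bracket account for
    [V `^ alpha]: the first for the visits to [C `*` C], the second for the
    drift. In the bracket, [lyap alpha g k v / E] bounds the sum of the
    rates when [C `*` C] is avoided, and each visit adds an excess [D * r]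
    whose expected total is the last term. *)
Definition pair_lyap m k v : R :=
  2 * b_V / (E * eps_nu) + (v - 1) / E
  + 2 * (lyap alpha g k v / E
         + D * A m k.+1 * (r k.+1 + lambda k * lyap alpha g k v)).

Let D0 : 0 <= D.
Proof. exact: divr_ge0 (mulr_ge0 (ler0n _ 2) (ltW b_V_gt0)) (ltW E0). Qed.
Let A0 m k : 0 <= A m k. Proof. exact: prod_series_ge0. Qed.

Lemma pair_lyap_ge0 m k v : 1 <= v -> 0 <= pair_lyap m k v.
Proof.
move=> v1; have G0 := lyap_ge0 alpha01 g0 k v1.
have EV0 : 0 <= E^-1 by rewrite invr_ge0 ltW.
have v0 : 0 <= v - 1 by rewrite subr_ge0.
have b0 : 0 <= 2 * b_V by rewrite mulr_ge0// ltW.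
apply: addr_ge0; first apply: addr_ge0.
- exact: divr_ge0 b0 (ltW (mulr_gt0 E0 en0)).
- exact: mulr_ge0.
apply: mulr_ge0 => //; apply: addr_ge0; first exact: mulr_ge0.
apply: mulr_ge0; first exact: mulr_ge0.
by apply: addr_ge0 => //; exact: mulr_ge0.
Qed.

(** One step of the supermartingale argument. As [pair_lyap] is concave in
    [v], it lies below a line, written as a function of [y + 1], which
    stands for [V x + V x']: integrating that line only needs the sum [S] of
    the means of [V]. With [w] for the sum of the two [V `^ alpha], the
    third clause is the step from outside [C `*` C], and the fourth one the
    step from [C `*` C], where the chains couple with probability [eps_nu]
    and each carries [V >= 1] away. *)
Lemma pair_lyap_step m k v : 1 <= v -> exists a s, [/\ 0 <= s,
  forall y, 1 <= y -> pair_lyap m k.+1 y <= a + s * (y + 1),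
  forall w S, v `^ alpha <= w -> S - 1 <= v - E * w ->
    2 * r k + w + (a + s * S) <= pair_lyap m.+1 k v &
  forall w S, v `^ alpha <= w -> S - 1 <= v - beta * w + 2 * b_V ->
    v <= 2 * c_V - 1 ->
    2 * r k + w + ((1 - eps_nu) * a + s * (S - 2 * eps_nu))
      <= pair_lyap m.+1 k v].
Proof.
move=> v1.
have [s [/andP[s0 s_le] tangent drift]] := lyap_drift alpha01 g0 k v1.
rewrite gE in drift.
set G := lyap alpha g k v in drift.
set G' := lyap alpha g k.+1 v in tangent drift.
have G0 : 0 <= G by exact: lyap_ge0.
have G'0 : 0 <= G' by exact: lyap_ge0.
have G'le : G' <= r k.+1 * (v - 1) by exact: lyap_le.
have sG' : s * (v - 1) <= G'.
  have := tangent 1 (lexx _); rewrite {1}/lyap powR1 subrr; lra.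
pose a' := A m k.+2; pose a := A m.+1 k.+1.
have aE : a = 1 + factor k.+1 * a' by exact: prod_seriesS.
have a'0 : 0 <= a' by exact: A0.
have a0 : 0 <= a by exact: A0.
have a'a : a' <= a.
  exact: le_trans (prod_series_shift factor_ge0 factorS k.+1 m)
                  (prod_series_mono factor_ge0 k.+1 m).
pose l := D * a'; have l0 : 0 <= l by exact: mulr_ge0.
pose cG := 2 * (E^-1 + l * lambda k.+1).
have EV0 : 0 < E^-1 by rewrite invr_gt0.
have cG0 : 0 <= cG.
  exact: mulr_ge0 (ler0n _ 2) (addr_ge0 (ltW EV0) (mulr_ge0 l0 (lambda_ge0 _))).
pose c0 := 2 * b_V / (E * eps_nu) + 2 * l * r k.+2.
have lyapE y : pair_lyap m k.+1 y = c0 + (y - 1) / E + cG * lyap alpha g k.+1 y.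
  by rewrite /pair_lyap -/a' -/l /c0 /cG; ring.
have lyap'E : pair_lyap m.+1 k v = 2 * b_V / (E * eps_nu) + (v - 1) / E
    + 2 * G / E + 2 * (D * a * r k.+1) + 2 * (D * a * lambda k * G).
  by rewrite /pair_lyap -/a -/G; ring.
have ll : l * lambda k.+1 * G <= D * a * lambda k * G.
  by rewrite ler_wpM2r// ler_pM// ler_wpM2l.
exists (c0 - 2 / E + cG * (G' - s * v - s)), (E^-1 + cG * s); split.
- exact: addr_ge0 (ltW EV0) (mulr_ge0 cG0 s0).
- move=> y y1; rewrite lyapE.
  have := ler_wpM2l cG0 (tangent y y1); lra.
- move=> w S vw Sv.
  have w0 : 0 <= w by rewrite (le_trans _ vw)// powR_ge0.
  have T : G' + s * (S - 1 - v) <= G - E * r k.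
    have : s * (S - 1 - v) <= s * (- (E * v `^ alpha)).
      rewrite ler_wpM2l//; have : E * v `^ alpha <= E * w by rewrite ler_pM2l.
      by lra.
    by move: drift; lra.
  have lin : (S - 2) / E <= (v - 1) / E - w.
    rewrite -[w](mulKf (x := E)) ?gt_eqF// [E^-1 * _]mulrC -mulrBl ler_pM2r//.
    by lra.
  have cT := ler_wpM2l cG0 T.
  have cGE : cG * (G - E * r k) = 2 * G / E + 2 * (l * lambda k.+1 * G)
      - 2 * r k - 2 * (l * (lambda k.+1 * E * r k)).
    by rewrite /cG; field; rewrite gt_eqF.
  have exc := ler_wpM2l l0 (rate_excursion k).
  have la : l * r k.+1 <= D * a * r k.+1 by rewrite ler_wpM2r// ler_wpM2l.
  rewrite lyap'E; move: cT; rewrite cGE /c0; lra.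
- move=> w S vw Sv vc.
  have w0 : 0 <= w by rewrite (le_trans _ vw)// powR_ge0.
  have Ew : E * w <= beta * w.
    rewrite ler_wpM2r// /E ler_piMl ?(ltW beta0)//.
    by case/andP: eps_b01 => _ /ltW.
  have Ev : E * v `^ alpha <= E * w by rewrite ler_pM2l.
  have b0 : 0 <= 2 * b_V by rewrite mulr_ge0// ltW.
  (* T bounds the mean of lyap after the step in two ways: T1 continues the
     sum of the rates, T2 starts the excursion to the next visit *)
  pose T := G' + s * (S - 1 - v).
  have sb : s * (2 * b_V) <= r k.+1 * (2 * b_V) by rewrite ler_wpM2r.
  have T1 : T <= G - E * r k + 2 * b_V * r k.+1.
    have : s * (S - 1 - v) <= s * (2 * b_V - E * v `^ alpha).
      by rewrite ler_wpM2l//; lra.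
    by move: drift; rewrite /T; lra.
  have T2 : T <= r k.+1 * (2 * c_V + 2 * b_V - 2).
    have : s * (S - 1 - v) <= s * (2 * b_V).
      by rewrite ler_wpM2l//; have := mulr_ge0 (ltW E0) w0; lra.
    have : r k.+1 * (v - 1) <= r k.+1 * (2 * c_V - 2).
      by rewrite ler_wpM2l//; lra.
    by rewrite /T; move: G'le sb; lra.
  have lin : (S - 2) / E <= (v - 1) / E - w + 2 * b_V / E.
    rewrite -[w](mulKf (x := E)) ?gt_eqF// [E^-1 * _]mulrC -mulrBl -mulrDl.
    by rewrite ler_pM2r//; lra.
  have cT : cG * T <= 2 * G / E - 2 * r k + 2 * D * r k.+1
      + 2 * (l * (lambda k.+1 * r k.+1 * (2 * c_V + 2 * b_V - 2))).
    have t1 := ler_wpM2l (ltW EV0) T1.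
    have t2 := ler_wpM2l (mulr_ge0 l0 (lambda_ge0 k.+1)) T2.
    have t1E : E^-1 * (G - E * r k + 2 * b_V * r k.+1)
        = G / E - r k + D * r k.+1.
      by rewrite /D; field; rewrite gt_eqF.
    by move: t1 t2; rewrite t1E /cG; lra.
  have vis := ler_wpM2l l0 (rate_visit k.+1).
  have es : eps_nu * (s * (v - 1)) <= eps_nu * G' by rewrite ler_pM2l.
  have ces := ler_wpM2l cG0 es.
  have c1E : eps_nu * (2 * b_V / (E * eps_nu)) = 2 * b_V / E.
    by field; rewrite !gt_eqF.
  have aE' : D * a * r k.+1 = D * r k.+1 + l * (factor k.+1 * r k.+1).
    by rewrite aE /l; ring.
  have lG : 0 <= D * a * lambda k * G.
    exact: mulr_ge0 (mulr_ge0 (mulr_ge0 D0 a0) (lambda_ge0 k)) G0.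
  by rewrite lyap'E aE' /c0; move: cT; rewrite /T; lra.
Qed.

Let cs : R := fine (cstar_const phi eps_nu eps_b b_V c_V).
Let cR : R := 2 / E * (2 + (2 * b_V + E) / eps_nu
  + cs * ((2 * b_V + E) * r 1 * (1 + r 1 / E))).

Lemma c_const_power : c_const phi eps_nu eps_b b_V c_V = cR%:E.
Proof.
rewrite /c_const -(fineK cstar_power_fin_num) -/cs /bbar_const r_rate_power//.
by rewrite /phi powR1 mulr1.
Qed.

Lemma pair_lyap_le_c_const m v : 1 <= v ->
  ((pair_lyap m 0 v)%:E
    <= ((1 + delta 0) * v)%:E * c_const phi eps_nu eps_b b_V c_V)%E.
Proof.
move=> v1; rewrite c_const_power -EFinM lee_fin /pair_lyap lyap0//.
have Acs : A m 1 <= cs.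
  rewrite -lee_fin /cs fineK ?cstar_power_fin_num//.
  exact: prod_series_le_cstar eps_nu01 M1_power_ge0 delta_rate_ge0 m.
have r0 := r_ge0 1; have d0 := delta_ge0 0; have A0' := A0 m 1.
have EV0 : 0 < E^-1 by rewrite invr_gt0.
pose c1 := 2 * b_V / (E * eps_nu); pose c2 := 2 * (D * A m 1 * r 1).
pose c3 := 2 * (D * A m 1 * (r 1 ^+ 2 / E)).
have c1_0 : 0 <= c1.
  exact: divr_ge0 (mulr_ge0 (ler0n _ 2) (ltW b_V_gt0)) (ltW (mulr_gt0 E0 en0)).
have DA0 : 0 <= D * A m 1 by exact: mulr_ge0.
have r2E0 : 0 <= r 1 ^+ 2 / E by exact: divr_ge0 (exprn_ge0 2 r0) (ltW E0).
have c2_0 : 0 <= c2 by exact: mulr_ge0 (ler0n _ 2) (mulr_ge0 DA0 r0).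
have c3_0 : 0 <= c3 by exact: mulr_ge0 (ler0n _ 2) (mulr_ge0 DA0 r2E0).
have -> : 2 * b_V / (E * eps_nu) + (v - 1) / E + 2 * ((v - 1) / E
    + D * A m 1 * (r 1 + lambda 0 * (v - 1)))
  = c1 + c2 + 3 * E^-1 * (v - 1) + c3 * (delta 0 * (v - 1)).
  by rewrite /c1 /c2 /c3 /lambda; ring.
have cRge : c1 + c2 + 4 * E^-1 + c3 <= cR.
  have BA : 2 * b_V * A m 1 <= (2 * b_V + E) * cs.
    apply: ler_pM => //; first exact: mulr_ge0 (ler0n _ 2) (ltW b_V_gt0).
    by rewrite lerDl ltW.
  have w0 : 0 <= r 1 + r 1 ^+ 2 / E by exact: addr_ge0.
  have := ler_wpM2l (mulr_ge0 (ler0n R 2) (ltW EV0)) (ler_wpM2r w0 BA).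
  have -> : 2 * E^-1 * (2 * b_V * A m 1 * (r 1 + r 1 ^+ 2 / E)) = c2 + c3.
    by rewrite /c2 /c3 /D; field; rewrite gt_eqF.
  have -> : cR = 2 * E^-1 * ((2 * b_V + E) * cs * (r 1 + r 1 ^+ 2 / E))
      + 4 * E^-1 + 2 * c1 + 2 * eps_nu^-1.
    by rewrite /cR /c1; field; rewrite !gt_eqF.
  have : 0 < eps_nu^-1 by rewrite invr_gt0.
  by lra.
have cR0 : 0 <= cR by move: cRge EV0; lra.
have v10 : 0 <= v - 1 by rewrite subr_ge0.
have t1 : 3 * E^-1 * (v - 1) <= cR * (v - 1).
  by rewrite ler_wpM2r//; move: cRge EV0; lra.
have t2 : c3 * (delta 0 * (v - 1)) <= cR * (delta 0 * (v - 1)).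
  by apply: ler_wpM2r; [exact: mulr_ge0|move: cRge EV0; lra].
have t3 : 0 <= cR * delta 0 by exact: mulr_ge0.
by move: cRge EV0 t1 t2 t3; lra.
Qed.

End pair_lyapunov.

(** * Oscillation of sums along the chain *)

Section drift_consequences.
Context d (X : measurableType d) (R : realType).
Variables (alpha beta eps_b eps_nu b_V c_V : R).
Variables (P : nat -> R.-pker X ~> X) (C : set X) (V : X -> R)
  (nu : nat -> probability X R).
Hypotheses (alpha01 : 0 <= alpha < 1) (beta0 : 0 < beta).

Let phi (v : R) : R := beta * v `^ alpha.

Hypothesis dm : drift_minorisation P C V phi nu eps_nu eps_b b_V c_V.

Let mV : measurable_fun setT V := dm_V_measurable dm.
Let V_ge1 : forall x, 1 <= V x := dm_V_ge1 dm.
Let phi_ge v : 1 <= v -> beta <= phi v.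
Proof.
move=> v1; rewrite ler_peMr ?(ltW beta0)// -(one_powR alpha) powR_le2r//.
by case/andP: alpha01.
Qed.

(** At a point where [V] is almost minimal, [V] cannot decrease by
    [phi (V x) >= beta] in the mean. *)
Lemma drift_level_gt0 (x0 : X) : exists2 x, C x & 0 < b_V.
Proof.
have Vinf : has_inf (range V).
  by split; [exists (V x0), x0|exists 1 => _ [x _ <-]].
have [_ [x _ <-] Vx] := inf_adherent beta0 Vinf.
have low : ((inf (range V))%:E <= \int[P 1 x]_y (V y)%:E)%E.
  have <- : (\int[P 1 x]_y (inf (range V))%:E)%E = (inf (range V))%:E.
    by rewrite integral_cst// prob_kernel mule1.
  apply: ge0_le_integral => //.
  - move=> y _; rewrite lee_fin; apply: lb_le_inf; first by case: Vinf.
    by move=> _ [z _ <-]; exact: le_trans (V_ge1 z).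
  - exact/measurable_EFinP.
  - by move=> y _; rewrite lee_fin; apply: ge_inf; [case: Vinf|exists y].
have := le_trans low (dm_drift dm x (ltn0Sn 0)); rewrite lee_fin.
have := phi_ge (V_ge1 x); rewrite indicE.
have [Cx|nCx] := pselect (C x); last by rewrite memNset// mulr0; lra.
by rewrite mem_set// mulr1 => ? ?; exists x => //; lra.
Qed.

Variable x0 : X.

Let b_gt0 : 0 < b_V. Proof. by have [] := drift_level_gt0 x0. Qed.

Lemma weight_le_level x : C x -> V x <= c_V.
Proof.
move=> Cx; rewrite -lee_fin; apply: le_trans (dm_in dm).
by apply: ereal_sup_ubound; exists x.
Qed.

Lemma level_ge1 : 1 <= c_V.
Proof.
have [x Cx _] := drift_level_gt0 x0.
exact: le_trans (V_ge1 x) (weight_le_level Cx).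
Qed.

Lemma weak_drift k x : (0 < k)%N ->
  (\int[P k x]_y (V y)%:E <= (V x + b_V)%:E)%E.
Proof.
move=> k0; apply: (le_trans (dm_drift dm x k0)); rewrite lee_fin.
have := phi_ge (V_ge1 x); have : b_V * \1_C x <= b_V.
  by rewrite ler_piMr ?(ltW b_gt0)// indicE; case: (_ \in _).
by move: beta0; lra.
Qed.

Lemma mean_drift k x : (0 < k)%N ->
  \int[P k x]_y V y <= V x - phi (V x) + b_V * \1_C x.
Proof.
move=> k0; rewrite -lee_fin fineK ?(dm_drift dm)//.
exact: integrable_fin_num (kernel_integrable_weight mV V_ge1 weak_drift x k0).
Qed.

Lemma level_le_outside x : ~ C x -> b_V <= (1 - eps_b) * phi (V x).
Proof.
move=> nCx; have eb1 : 0 < 1 - eps_b by case/andP: (dm_eps_b dm) => _; lra.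
rewrite mulrC -ler_pdivrMr// -lee_fin; apply: (le_trans (dm_out dm)).
by apply: ereal_inf_lbound; exists x.
Qed.

Let g : R := eps_b * beta * (1 - alpha).
Local Notation r := (poly_rate alpha g).
Local Notation W := (pair_lyap alpha beta eps_b eps_nu b_V c_V).

(** Backward induction on the time: the bound at time [k.+1] controls the
    oscillation of the continuation [h], hence the difference of its means
    under [P k.+1 y] and [P k.+1 y'], by a coupling at rate [eps_nu] if both
    points are in [C], and at rate [0] otherwise. *)
Lemma backward_sum_oscillation (f : nat -> X -> R) (M : R) m k x x' :
  0 <= M -> (forall n, weight_bounded V (f n)) ->
  (forall n y, `|f n y| <= M * (r n + V y `^ alpha)) ->
  `|backward_sum P f m k x - backward_sum P f m k x'|
    <= M * W m k (V x + V x' - 1).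
Proof.
move=> M0 bf f_le.
have eb01 := dm_eps_b dm; have en01 := dm_eps_nu dm.
have [eb0 eb1] := andP eb01; have [en0 en1] := andP en01.
have [al0 al1] := andP alpha01.
have v_ge1 y y' : 1 <= V y + V y' - 1.
  by have := V_ge1 y; have := V_ge1 y'; lra.
elim: m k x x' => [|m IH] k x x'.
  by rewrite /= subrr normr0 mulr_ge0// pair_lyap_ge0// level_ge1.
suff half y y' : backward_sum P f m.+1 k y - backward_sum P f m.+1 k y'
    <= M * W m.+1 k (V y + V y' - 1).
  rewrite ler_norml half andbT lerNl opprB.
  by have := half x' x; rewrite [V x' + V x]addrC.
have bb := backward_sum_bounded mV V_ge1 (ltW b_gt0) weak_drift m k.+1 bf.
set h := backward_sum P f m k.+1 in bb *.
have [a [s [s0 tangent out_step in_step]]] := pair_lyap_step alpha01 beta0 eb01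
  en01 b_gt0 level_ge1 m k (v_ge1 y y').
have osc z z' : h z - h z' <= M * a + M * s * (V z + V z').
  apply: (le_trans (ler_norm _)); apply: (le_trans (IH k.+1 z z')).
  rewrite -mulrA -mulrDr ler_wpM2l//.
  by have := tangent _ (v_ge1 z z'); rewrite subrK.
have Ms0 : 0 <= M * s by exact: mulr_ge0.
have iV z := kernel_integrable_weight mV V_ge1 weak_drift z (ltn0Sn k).
have ih z := weight_bounded_integrable (iV z) bb.
have coupled e (e0 : 0 <= e) min min' := @mean_diff_minorised _ X R
  (P k.+1 y) (P k.+1 y') (nu k.+1) e (M * a) (M * s) h V (prob_kernel _)
  (prob_kernel _) e0 Ms0 min min' mV bb.1 V_ge1 (iV y) (iV y') (ih y) (ih y')
  osc.
pose S := \int[P k.+1 y]_z V z + \int[P k.+1 y']_z V z.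
pose w := V y `^ alpha + V y' `^ alpha.
have vw : (V y + V y' - 1) `^ alpha <= w.
  by apply: powR_subadditive => //; rewrite al0 ltW.
have cost : f k y - f k y' <= M * (2 * r k + w).
  have := f_le k y; have := f_le k y'.
  rewrite !ler_norml => /andP[+ _] /andP[_].
  by rewrite /w; lra.
have dy := mean_drift y (ltn0Sn k); have dy' := mean_drift y' (ltn0Sn k).
have phi_ge0 z : 0 <= phi (V z).
  exact: le_trans (ltW beta0) (phi_ge (V_ge1 z)).
have wE : beta * w = phi (V y) + phi (V y') by rewrite mulrDr.
rewrite /=; have [[Cy Cy']|nCC] := pselect (C y /\ C y').
  move: dy dy'; rewrite !indicE !mem_set// !mulr1 => dy dy'.
  have SE : S - 1 <= V y + V y' - 1 - beta * w + 2 * b_V.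
    by rewrite wE /S; lra.
  have vc : V y + V y' - 1 <= 2 * c_V - 1.
    by have := weight_le_level Cy; have := weight_le_level Cy'; lra.
  have min z A : C z -> measurable A -> (eps_nu%:E * nu k.+1 A <= P k.+1 z A)%E.
    by move=> Cz mA; exact: dm_minorisation dm _ _ _ (ltn0Sn k) Cz mA.
  have mean := coupled eps_nu (ltW en0) (fun A => min y A Cy)
    (fun A => min y' A Cy').
  have := ler_wpM2l M0 (in_step w S vw SE vc).
  by move: mean cost; rewrite /S; lra.
(* at most one point is in C, and the drift at the other one absorbs b_V *)
have SE : S - 1 <= V y + V y' - 1 - eps_b * beta * w.
  have ew : eps_b * beta * w = eps_b * phi (V y) + eps_b * phi (V y').
    by rewrite -mulrA wE mulrDr.
  have ephi z : eps_b * phi (V z) <= phi (V z) by rewrite ler_piMl// ltW.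
  have e1 := ephi y; have e1' := ephi y'.
  rewrite ew; move: dy dy'; rewrite !indicE /S.
  have [Cy|nCy] := pselect (C y); have [Cy'|nCy'] := pselect (C y').
  - by exfalso; apply: nCC.
  - rewrite mem_set// memNset// mulr1 mulr0.
    by have := level_le_outside nCy'; lra.
  - rewrite memNset// mem_set// mulr1 mulr0.
    by have := level_le_outside nCy; lra.
  - by rewrite !memNset// !mulr0; lra.
have min z A : measurable A -> (0%:E * nu k.+1 A <= P k.+1 z A)%E.
  by move=> mA; rewrite mul0e.
have mean := coupled 0 (lexx _) (min y) (min y').
have := ler_wpM2l M0 (out_step w S vw SE).
by move: mean cost; rewrite /S subr0 mul1r mulr0 subr0; lra.
Qed.

End drift_consequences.

(** * Convergence of the weighted series *)

Lemma polynomial_weight_le (R : realType) (alpha xi g : R) n :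
  0 <= alpha < 1 -> 0 <= xi -> 0 < g ->
  n.+1%:R `^ (xi * alpha / (1 - alpha))
    <= (1 + g^-1) `^ (xi * alpha / (1 - alpha)) * poly_rate alpha g n `^ xi.
Proof.
move=> /andP[a0 a1] xi0 g0.
have gV0 : 0 < g^-1 by rewrite invr_gt0.
have gn0 : 0 <= g * n%:R by rewrite mulr_ge0// ltW.
rewrite /poly_rate -powRrM.
have -> : alpha / (1 - alpha) * xi = xi * alpha / (1 - alpha).
  by rewrite mulrC mulrA.
rewrite -powRM; [|exact: addr_ge0 ler01 (ltW gV0)|exact: addr_ge0].
apply: powR_le2r => //.
  by rewrite divr_ge0 ?mulr_ge0//; move: a1; lra.
have -> : (1 + g^-1) * (1 + g * n%:R) = n.+1%:R + (g * n%:R + g^-1).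
  by rewrite -natr1; field; rewrite gt_eqF.
by rewrite lerDl addr_ge0// ltW.
Qed.

Theorem corollary5 (R : realType) (alpha beta eps_b xi : R)
    (hbeta : 0 < beta) (halpha : 0 <= alpha < 1)
    (heps_b : 0 < eps_b < 1) (hxi : 0 <= xi <= 1) :
  exists K : R,
    forall (d : measure_display) (X : measurableType d)
      (P : nat -> R.-pker X ~> X) (C : set X) (V : X -> R)
      (nu : nat -> probability X R) (eps_nu b_V c_V : R),
    let phi := fun v : R => beta * v `^ alpha in
    let W := fun x : X => V x `^ (alpha * (1 - xi)) in
    let c := c_const phi eps_nu eps_b b_V c_V in
    drift_minorisation P C V phi nu eps_nu eps_b b_V c_V ->
    (c < +oo)%E /\
    forall f : X -> R,
      measurable_fun setT f ->
      (weighted_norm W f < +oo)%E ->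
      forall x x' : X,
        (\sum_(0 <= n <oo)
           ((n.+1%:R `^ (xi * alpha / (1 - alpha)))%:E *
            `| kernel_app (kernel_prod P n) f x
               - kernel_app (kernel_prod P n) f x' |)
         <= K%:E * c * weighted_norm W f * (V x + V x' - 1)%:E)%E.
Proof.
have [eb0 eb1] := andP heps_b; have [a0 a1] := andP halpha.
have [xi0 xi1] := andP hxi.
pose g := eps_b * beta * (1 - alpha).
have g0 : 0 < g by rewrite !mulr_gt0// subr_gt0.
pose K1 := (1 + g^-1) `^ (xi * alpha / (1 - alpha)).
have K1_ge0 : 0 <= K1 by exact: powR_ge0.
exists (K1 * (1 + poly_rate_dlog alpha g 0)).
move=> d X P C V nu eps_nu b_V c_V phi W c dm.
(* the probability measures nu make the space nonempty *)
have [x0 _] : [set: X] !=set0.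
  apply/set0P/eqP => X0; have := probability_setT (nu 0).
  by rewrite X0 measure0 => /eqP; rewrite eq_sym onee_eq0.
have en01 := dm_eps_nu dm.
have [_ _ b_gt0] := drift_level_gt0 halpha hbeta dm x0.
have c_ge1 := level_ge1 halpha hbeta dm x0.
have c_fin := c_const_power halpha hbeta heps_b en01 b_gt0 c_ge1.
split; first by rewrite /c c_fin ltry.
move=> f mf f_fin x x'.
have V_ge1 := dm_V_ge1 dm; have mV := dm_V_measurable dm.
have V_gt0 y : 0 < V y by exact: lt_le_trans (V_ge1 y).
have drift := weak_drift halpha hbeta dm x0.
have norm_ge0 : (0 <= weighted_norm W f)%E.
  apply: le_trans (ereal_sup_ubound _); last by exists x.
  by rewrite lee_fin divr_ge0// powR_ge0.
pose N := fine (weighted_norm W f).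
have NE : weighted_norm W f = N%:E by rewrite fineK// ge0_fin_numE.
have N_ge0 : 0 <= N by rewrite -lee_fin -NE.
have f_le y : `|f y| <= N * (V y `^ alpha) `^ (1 - xi).
  rewrite -powRrM -ler_pdivrMr ?powR_gt0// -lee_fin -NE.
  by apply: ereal_sup_ubound; exists y.
pose w n : R := n.+1%:R `^ (xi * alpha / (1 - alpha)).
have w_ge0 n : 0 <= w n by exact: powR_ge0.
have wf_le n y : w n * `|f y| <= N * K1 * (poly_rate alpha g n + V y `^ alpha).
  have rate0 : 0 <= poly_rate alpha g n by exact: powR_ge0.
  apply: (@le_trans _ _ (K1 * poly_rate alpha g n `^ xi
                         * (N * (V y `^ alpha) `^ (1 - xi)))).
    by apply: ler_pM => //; exact: polynomial_weight_le.
  have -> : K1 * poly_rate alpha g n `^ xi * (N * (V y `^ alpha) `^ (1 - xi))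
    = N * K1 * (poly_rate alpha g n `^ xi * (V y `^ alpha) `^ (1 - xi)) by ring.
  apply: ler_wpM2l; first exact: mulr_ge0.
  by apply: powR_interpolation => //; exact: powR_ge0.
have bf : weight_bounded V f.
  split=> //; exists N => y; apply: (le_trans (f_le y)).
  rewrite ler_wpM2l// -powRrM -[leRHS](powRr1 (ltW (V_gt0 y))) ler_powR//.
  have : alpha * (1 - xi) <= alpha * 1 by rewrite ler_wpM2l//; lra.
  by lra.
have bZ (a : R) : weight_bounded V (fun y => a * f y).
  split; first exact: measurable_funM.
  case: bf => _ [b Hb]; exists (`|a| * b) => y.
  by rewrite normrM -mulrA ler_wpM2l.
pose mean n y := \int[kernel_prod P n y]_z f z.
have intf n y : (kernel_prod P n y).-integrable setT (EFin \o f).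
  apply: weight_bounded_integrable bf.
  exact: kernel_prod_integrable_weight mV V_ge1 (ltW b_gt0) drift n y.
have appE n y : kernel_app (kernel_prod P n) f y = (mean n y)%:E.
  by rewrite /mean /Rintegral fineK//; exact: integrable_fin_num (intf n y).
(* the signs turn the sum of absolute values into the difference of a single
   backward sum at x and x' *)
pose F n (y : X) := w n * Num.sg (mean n x - mean n x') * f y.
have F_le n y : `|F n y| <= N * K1 * (poly_rate alpha g n + V y `^ alpha).
  apply: le_trans (wf_le n y); rewrite /F !normrM (ger0_norm (w_ge0 n)).
  rewrite ler_wpM2r// ler_piMr// normr_sg.
  by case: (_ != 0).
have bF n : weight_bounded V (F n) by exact: bZ.
have partial m : \sum_(i < m) w i * `|mean i x - mean i x'|
    = backward_sum P F m 0 x - backward_sum P F m 0 x'.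
  rewrite !(backward_sumE mV V_ge1 (ltW b_gt0) drift) // -sumrB.
  apply: eq_bigr => i _; rewrite !RintegralZl// -/(mean i x) -/(mean i x').
  by rewrite -mulrBr -mulrA -normrEsg.
set v := V x + V x' - 1.
have v_ge1 : 1 <= v by rewrite /v; have := V_ge1 x; have := V_ge1 x'; lra.
apply: lime_le.
  by apply: is_cvg_nneseries => n _ _; rewrite mule_ge0// lee_fin.
apply: nearW => m; rewrite big_mkord.
under eq_bigr do rewrite !appE -EFinB/= -EFinM.
rewrite sumEFin (partial m).
have NK_ge0 : 0 <= N * K1 by exact: mulr_ge0.
have osc := backward_sum_oscillation halpha hbeta dm x0 m 0 x x' NK_ge0 bF F_le.
apply: (@le_trans _ _ ((N * K1)%:E
    * (pair_lyap alpha beta eps_b eps_nu b_V c_V m 0 v)%:E)%E).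
  by rewrite -EFinM lee_fin (le_trans (ler_norm _)).
apply: (le_trans (lee_wpmul2l _
  (pair_lyap_le_c_const halpha hbeta heps_b en01 b_gt0 c_ge1 m v_ge1))).
  by rewrite lee_fin.
rewrite NE /c c_fin -!EFinM lee_fin le_eqVlt; apply/orP; left; apply/eqP.
by rewrite /g; ring.
Qed.
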